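(* Let $w\in W=S_{n+1}$, and let $\mathbf x,\mathbf y$ be reduced expressions of $w$. Let $f$ and $g$ be two oriented paths from $\mathbf x$ to $\mathbf y$ in the expanded expression graph $\tilde\Gamma_w$ (respectively, two reverse oriented paths from $\mathbf x$ to $\mathbf y$). Then the path morphisms of $f$ and $g$ are equal as morphisms $\mathbf x\to\mathbf y$ in $\mathcal D$.
   Context: **Notation.** $\Bbbk$ is a field of characteristic $\ne2$, $I=\{1,\dots,n\}$, $W=S_{n+1}$ with simple reflections $s_i$, $i\in I$. Indices $i,j$ are adjacent if $|i-j|=1$ and distant if $|i-j|\ge2$. $R=\Bbbk[f_1,\dots,f_n]$, $\deg f_i=2$, with $W$ acting by algebra automorphisms: $s_i(f_i)=-f_i$, $s_i(f_j)=f_i+f_j$ for adjacent $i,j$, $s_i(f_j)=f_j$ for distant $i,j$; $\partial_i(f)=(f-s_i(f))/f_i$. **The category $\mathcal D$.** $\mathcal D$ is the $\Bbbk$-linear strict monoidal category with graded Hom spaces whose objects are finite sequences of elements of $I$ (tensor product is concatenation, unit the empty sequence $\emptyset$), with generating morphisms: dots $\epsilon_i:i\to\emptyset$, $\eta_i:\emptyset\to i$ (degree $1$); trivalent vertices $\mu_i:ii\to i$, $\delta_i:i\to ii$ (degree $-1$); 4-valent vertices $X_{ij}:ij\to ji$ for distant $i,j$ (degree $0$); 6-valent vertices $T_{ij}:iji\to jij$ for adjacent $i,j$ (degree $0$). Put $\mathrm{cap}_i=\epsilon_i\mu_i$, $\mathrm{cup}_i=\delta_i\eta_i$, and identify $f_i\in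 R$ with $\epsilon_i\eta_i\in\mathrm{End}(\emptyset)$ (so $R$ acts on Hom spaces on left and right). The relations, together with all their left-right and upside-down reflections, are: (1) $(i,\mu_i,\eta_i,\delta_i,\epsilon_i)$ is a Frobenius algebra object and $\mu_i\delta_i=0$; morphisms are invariant under planar isotopy, i.e. rotating a 4- or 6-valent vertex using cups and caps gives the 4- or 6-valent vertex with the rotated boundary. (2) $f\otimes 1_i=1_i\otimes s_i(f)+\partial_i(f)\,\eta_i\epsilon_i$ for $f\in R$ ($\partial_i(f)$ placed on the left). (3) For distant $i,j$: $X_{ji}X_{ij}=1_{ij}$, $(1_j\otimes\epsilon_i)X_{ij}=\epsilon_i\otimes1_j$, $X_{ij}(\mu_i\otimes1_j)=(1_j\otimes\mu_i)(X_{ij}\otimes1_i)(1_i\otimes X_{ij})$. For mutually distant $i,j,k$: $(X_{jk}\otimes1_i)(1_j\otimes X_{ik})(X_{ij}\otimes1_k)=(1_k\otimes X_{ij})(X_{ik}\otimes1_j)(1_i\otimes X_{jk})$. If $k$ is distant from adjacent $i,j$, a $k$-strand slides past $T_{ij}$ through 4-valent vertices. (4) For adjacent $i,j$, with $A_{ij}=\mu_i(1_i\otimes\epsilon_j\otimes1_i):iji\to i$ and $A_{ij}^*=(1_i\otimes\eta_j\otimes1_i)\delta_i$: $(\epsilon_j\otimes1_{ij})T_{ij}=1_{ij}\otimes\epsilon_i+A_{ij}\otimes\eta_j$; $T_{ji}T_{ij}=1_{iji}+A_{ij}^*A_{ij}$; $T_{ij}(\mu_i\otimes1_{ji})=(1_{ji}\otimes\mu_j)(T_{ij}\otimes1_j)(1_i\otimes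 T_{ij})$. (5) For $a,b,c=i,i+1,i+2$, the two composites of 4- and 6-valent vertices $abacba\to cbcabc$ along $abacba\to babcba\to bacbca\to bcabac\to bcbabc\to cbcabc$ and $abacba\to abcaba\to abcbab\to acbcab\to cabacb\to cbabcb\to cbacbc\to cbcabc$ are equal (distant moves are via 4-valent vertices). **Paths.** For $w\in W$, $\tilde\Gamma_w$ is the graph whose vertices are the reduced expressions of $w$ (sequences of indices, viewed as objects of $\mathcal D$), with an unoriented distant edge for each move $ij\leftrightarrow ji$ ($i,j$ distant), and an adjacent edge oriented from $\cdots i(i+1)i\cdots$ to $\cdots(i+1)i(i+1)\cdots$. An oriented path traverses distant edges freely and adjacent edges only along the orientation; a reverse oriented path is an oriented path traversed backwards. The path morphism of a path is the composite in $\mathcal D$ of the 4-valent vertices (for distant edges) and 6-valent vertices (for adjacent edges) along it, tensored with identities; a path of length $0$ gives the identity. *)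

(* Defs.v *)
From HB Require Import structures.
From mathcomp Require Import all_boot all_order all_fingroup all_algebra.
From mathcomp Require Import mpoly.

Set Implicit Arguments.
Unset Strict Implicit.
Unset Printing Implicit Defensive.

Import GRing.Theory.
Local Open Scope ring_scope.

Declare Scope diag_scope.
Delimit Scope diag_scope with D.

Reserved Notation "g \oD f" (at level 40, left associativity).
Reserved Notation "f \xD g" (at level 38, right associativity).
Reserved Notation "f =D g" (at level 70, no associativity).

(* The index set {1, ..., n} is encoded as 'I_n = {0, ..., n - 1}; only
   differences of indices matter. *)

Section Indices.
Variable n : nat.
Implicit Types i j : 'I_n.

Definition adjacent i j : bool := (i.+1 == j :> nat) || (j.+1 == i :> nat).
Definition distant i j : bool := (i.+1 < j)%N || (j.+1 < i)%N.

Lemma adjacent_sym i j : adjacent i j -> adjacent j i.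
Proof. by rewrite /adjacent orbC. Qed.

Lemma distant_sym i j : distant i j -> distant j i.
Proof. by rewrite /distant orbC. Qed.

Definition simple_refl i : 'S_n.+1 := tperm (inord i) (inord i.+1).

Definition word_prod (x : seq 'I_n) : 'S_n.+1 :=
  (\prod_(i <- x) simple_refl i)%g.

Definition reduced (w : 'S_n.+1) (x : seq 'I_n) : Prop :=
  word_prod x = w /\ forall y, word_prod y = w -> (size x <= size y)%N.

End Indices.

Section WeylAction.
Variables (k : fieldType) (n : nat).
Local Notation R := {mpoly k[n]}.

Definition refl_gen (i j : 'I_n) : R :=
  if i == j then - 'X_j else if adjacent i j then 'X_i + 'X_j else 'X_j.

Definition refl_act (i : 'I_n) (f : R) : R :=
  comp_mpoly [tuple refl_gen i j | j < n] f.

(* [is_demazure i f g] says g = (f - s_i(f)) / f_i.  As {mpoly k[n]} is an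
   integral domain, such a g is unique. *)
Definition is_demazure (i : 'I_n) (f g : R) : Prop :=
  f - refl_act i f = 'X_i * g.

End WeylAction.

Section DiagrammaticCategory.
Variables (k : fieldType) (n : nat).
Local Notation I := 'I_n.
Implicit Types (x y z t u v : seq I) (i j : I).

Inductive gen : seq I -> seq I -> Type :=
| GEps i : gen [:: i] [::]
| GEta i : gen [::] [:: i]
| GMu i : gen [:: i; i] [:: i]
| GDelta i : gen [:: i] [:: i; i]
| GX i j of distant i j : gen [:: i; j] [:: j; i]
| GT i j of adjacent i j : gen [:: i; j; i] [:: j; i; j].

(* Formal k-linear combinations of diagrams; the morphisms of the category are
   their classes modulo [mor_eq] below. *)
Inductive mor : seq I -> seq I -> Type :=
| Gen x y of gen x y : mor x y
| Id x : mor x x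
| Comp x y z of mor y z & mor x y : mor x z
| Tens x y z t of mor x y & mor z t : mor (x ++ z) (y ++ t)
| Zero x y : mor x y
| Add x y of mor x y & mor x y : mor x y
| Scale x y of k & mor x y : mor x y.

Arguments Zero {x y}.

Local Notation "g \oD f" := (Comp g f).
Local Notation "f \xD g" := (Tens f g).

Definition castm x x' y y' (ex : x = x') (ey : y = y') (f : mor x y) :
    mor x' y' :=
  match ex in _ = a, ey in _ = b return mor a b with
  | erefl, erefl => f
  end.

Lemma castm_id x y (ex : x = x) (ey : y = y) (f : mor x y) : castm ex ey f = f.
Proof. by rewrite (eq_irrelevance ex erefl) (eq_irrelevance ey erefl). Qed.

Definition gen_degree x y (g : gen x y) : int :=
  match g with
  | GEps _ | GEta _ => 1
  | GMu _ | GDelta _ => - 1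
  | GX _ _ _ | GT _ _ _ => 0
  end.

(* The grading of the Hom spaces.  The relations below span a homogeneous
   ideal, so the grading plays no role in the equality of morphisms. *)
Inductive has_degree : forall x y, mor x y -> int -> Prop :=
| DegGen x y (g : gen x y) : has_degree (Gen g) (gen_degree g)
| DegId x : has_degree (Id x) 0
| DegComp x y z (g : mor y z) (f : mor x y) d e :
    has_degree g d -> has_degree f e -> has_degree (g \oD f) (d + e)
| DegTens x y z t (f : mor x y) (g : mor z t) d e :
    has_degree f d -> has_degree g e -> has_degree (f \xD g) (d + e)
| DegZero x y d : has_degree (@Zero x y) d
| DegAdd x y (f g : mor x y) d :
    has_degree f d -> has_degree g d -> has_degree (Add f g) d
| DegScale x y a (f : mor x y) d : has_degree f d -> has_degree (Scale a f) d.

Definition gen_upside_down x y (g : gen x y) : gen y x :=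
  match g in gen a b return gen b a with
  | GEps i => GEta i
  | GEta i => GEps i
  | GMu i => GDelta i
  | GDelta i => GMu i
  | GX i j d => GX (distant_sym d)
  | GT i j a => GT (adjacent_sym a)
  end.

Definition gen_left_right x y (g : gen x y) : gen (rev x) (rev y) :=
  match g in gen a b return gen (rev a) (rev b) with
  | GEps i => GEps i
  | GEta i => GEta i
  | GMu i => GMu i
  | GDelta i => GDelta i
  | GX i j d => GX (distant_sym d)
  | GT i j a => GT a
  end.

Fixpoint upside_down x y (f : mor x y) : mor y x :=
  match f in mor a b return mor b a with
  | Gen _ _ g => Gen (gen_upside_down g)
  | Id x => Id x
  | Comp _ _ _ g f => upside_down f \oD upside_down g
  | Tens _ _ _ _ f g => upside_down f \xD upside_down g
  | Zero _ _ => Zero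
  | Add _ _ f g => Add (upside_down f) (upside_down g)
  | Scale _ _ a f => Scale a (upside_down f)
  end.

Fixpoint left_right x y (f : mor x y) : mor (rev x) (rev y) :=
  match f in mor a b return mor (rev a) (rev b) with
  | Gen _ _ g => Gen (gen_left_right g)
  | Id x => Id (rev x)
  | Comp _ _ _ g f => left_right g \oD left_right f
  | Tens x y z t f g =>
      castm (esym (rev_cat x z)) (esym (rev_cat y t))
        (left_right g \xD left_right f)
  | Zero _ _ => Zero
  | Add _ _ f g => Add (left_right f) (left_right g)
  | Scale _ _ a f => Scale a (left_right f)
  end.

Definition eps i : mor [:: i] [::] := Gen (GEps i).
Definition eta i : mor [::] [:: i] := Gen (GEta i).
Definition mu i : mor [:: i; i] [:: i] := Gen (GMu i).
Definition delta i : mor [:: i] [:: i; i] := Gen (GDelta i).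
Definition X4 i j (d : distant i j) : mor [:: i; j] [:: j; i] := Gen (GX d).
Definition T6 i j (a : adjacent i j) : mor [:: i; j; i] [:: j; i; j] :=
  Gen (GT a).

Definition cap i : mor [:: i; i] [::] := eps i \oD mu i.
Definition cup i : mor [::] [:: i; i] := delta i \oD eta i.

Definition A3 i j : mor [:: i; j; i] [:: i] :=
  mu i \oD (Id [:: i] \xD eps j \xD Id [:: i]).
Definition A3star i j : mor [:: i] [:: i; j; i] :=
  (Id [:: i] \xD eta j \xD Id [:: i]) \oD delta i.

(* The algebra morphism R -> End(unit) sending f_i to eps_i \o eta_i. *)
Definition box (f : {mpoly k[n]}) : mor [::] [::] :=
  \big[@Add [::] [::]/Zero]_(m <- msupp f)
    Scale f@_m (\big[@Comp [::] [::] [::]/Id [::]]_(i < n)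
      iter (m i) (Comp (eps i \oD eta i)) (Id [::])).

Definition whisker u x y v (f : mor x y) : mor (u ++ x ++ v) (u ++ y ++ v) :=
  Id u \xD f \xD Id v.

(* Defining relations of the category, over and above those of a k-linear
   strict monoidal category; closed under both reflections.  The data
   a, b, c = i, i+1, i+2 is given by equations on the underlying naturals, and
   adjacency and distance proofs, being proofs of boolean facts, are
   irrelevant. *)
Inductive rel : forall x y, mor x y -> mor x y -> Prop :=
| rel_upside_down x y (f g : mor x y) :
    rel f g -> rel (upside_down f) (upside_down g)
| rel_left_right x y (f g : mor x y) :
    rel f g -> rel (left_right f) (left_right g)
(* Frobenius algebra objects *)
| rel_mulA i :
    @rel [:: i; i; i] [:: i]
      (mu i \oD (mu i \xD Id [:: i])) (mu i \oD (Id [:: i] \xD mu i))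
| rel_mul1l i : @rel [:: i] [:: i] (mu i \oD (eta i \xD Id [:: i])) (Id [:: i])
| rel_mul1r i : @rel [:: i] [:: i] (mu i \oD (Id [:: i] \xD eta i)) (Id [:: i])
| rel_comulA i :
    @rel [:: i] [:: i; i; i]
      ((delta i \xD Id [:: i]) \oD delta i) ((Id [:: i] \xD delta i) \oD delta i)
| rel_comul1l i :
    @rel [:: i] [:: i] ((eps i \xD Id [:: i]) \oD delta i) (Id [:: i])
| rel_comul1r i :
    @rel [:: i] [:: i] ((Id [:: i] \xD eps i) \oD delta i) (Id [:: i])
| rel_frobl i :
    @rel [:: i; i] [:: i; i]
      ((mu i \xD Id [:: i]) \oD (Id [:: i] \xD delta i)) (delta i \oD mu i)
| rel_frobr i :
    @rel [:: i; i] [:: i; i]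
      ((Id [:: i] \xD mu i) \oD (delta i \xD Id [:: i])) (delta i \oD mu i)
| rel_needle i : @rel [:: i] [:: i] (mu i \oD delta i) Zero
(* rotation of the 4- and 6-valent vertices by one click; isotopy for dots and
   trivalent vertices follows from the Frobenius relations *)
| rel_rotX i j (dij : distant i j) (dji : distant j i) :
    @rel [:: j; i] [:: i; j]
      ((cap j \xD Id [:: i; j])
         \oD (Id [:: j] \xD X4 dij \xD Id [:: j])
         \oD (Id [:: j; i] \xD cup j))
      (X4 dji)
| rel_rotT i j (aij : adjacent i j) (aji : adjacent j i) :
    @rel [:: j; i; j] [:: i; j; i]
      ((cap j \xD Id [:: i; j; i])
         \oD (Id [:: j] \xD T6 aij \xD Id [:: i])
         \oD (Id [:: j; i; j] \xD cup i))
      (T6 aji)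
(* polynomial forcing *)
| rel_force i (f g : {mpoly k[n]}) : is_demazure i f g ->
    @rel [:: i] [:: i]
      (box f \xD Id [:: i])
      (Add (Id [:: i] \xD box (refl_act i f)) (box g \xD (eta i \oD eps i)))
(* distant relations *)
| rel_XX i j (dij : distant i j) (dji : distant j i) :
    @rel [:: i; j] [:: i; j] (X4 dji \oD X4 dij) (Id [:: i; j])
| rel_Xeps i j (dij : distant i j) :
    @rel [:: i; j] [:: j]
      ((Id [:: j] \xD eps i) \oD X4 dij) (eps i \xD Id [:: j])
| rel_Xmu i j (dij : distant i j) :
    @rel [:: i; i; j] [:: j; i]
      (X4 dij \oD (mu i \xD Id [:: j]))
      ((Id [:: j] \xD mu i) \oD (X4 dij \xD Id [:: i])
         \oD (Id [:: i] \xD X4 dij))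
| rel_XXX i j l (dij : distant i j) (dil : distant i l) (djl : distant j l) :
    @rel [:: i; j; l] [:: l; j; i]
      ((X4 djl \xD Id [:: i]) \oD (Id [:: j] \xD X4 dil)
         \oD (X4 dij \xD Id [:: l]))
      ((Id [:: l] \xD X4 dij) \oD (X4 dil \xD Id [:: j])
         \oD (Id [:: i] \xD X4 djl))
| rel_XT i j l (aij : adjacent i j) (dil : distant i l) (djl : distant j l) :
    @rel [:: i; j; i; l] [:: l; j; i; j]
      ((X4 djl \xD Id [:: i; j]) \oD (Id [:: j] \xD X4 dil \xD Id [:: j])
         \oD (Id [:: j; i] \xD X4 djl) \oD (T6 aij \xD Id [:: l]))
      ((Id [:: l] \xD T6 aij) \oD (X4 dil \xD Id [:: j; i])
         \oD (Id [:: i] \xD X4 djl \xD Id [:: i]) \oD (Id [:: i; j] \xD X4 dil))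
(* adjacent relations *)
| rel_Teps i j (aij : adjacent i j) :
    @rel [:: i; j; i] [:: i; j]
      ((eps j \xD Id [:: i; j]) \oD T6 aij)
      (Add (Id [:: i; j] \xD eps i) (A3 i j \xD eta j))
| rel_TT i j (aij : adjacent i j) (aji : adjacent j i) :
    @rel [:: i; j; i] [:: i; j; i]
      (T6 aji \oD T6 aij) (Add (Id [:: i; j; i]) (A3star i j \oD A3 i j))
| rel_Tmu i j (aij : adjacent i j) :
    @rel [:: i; i; j; i] [:: j; i; j]
      (T6 aij \oD (mu i \xD Id [:: j; i]))
      ((Id [:: j; i] \xD mu j) \oD (T6 aij \xD Id [:: j])
         \oD (Id [:: i] \xD T6 aij))
(* Zamolodchikov relation of type A3; read the composites from bottom to top *)
| rel_zam (a b c : I) (eb : b = a.+1 :> nat) (ec : c = b.+1 :> nat)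
    (ab : adjacent a b) (bc : adjacent b c)
    (ac : distant a c) (ca : distant c a) :
    @rel [:: a; b; a; c; b; a] [:: c; b; c; a; b; c]
      ((T6 bc \xD Id [:: a; b; c])
         \oD (Id [:: b; c] \xD T6 ab \xD Id [:: c])
         \oD (Id [:: b] \xD X4 ac \xD Id [:: b] \xD X4 ca)
         \oD (Id [:: b; a] \xD T6 bc \xD Id [:: a])
         \oD (T6 ab \xD Id [:: c; b; a]))
      ((Id [:: c; b] \xD X4 ac \xD Id [:: b; c])
         \oD (Id [:: c; b; a] \xD T6 bc)
         \oD (Id [:: c] \xD T6 ab \xD Id [:: c; b])
         \oD (X4 ac \xD Id [:: b] \xD X4 ca \xD Id [:: b])
         \oD (Id [:: a] \xD T6 bc \xD Id [:: a; b])
         \oD (Id [:: a; b; c] \xD T6 ab)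
         \oD (Id [:: a; b] \xD X4 ac \xD Id [:: b; a])).

(* Equality of morphisms: the congruence generated by the axioms of a k-linear
   strict monoidal category and by [rel].  The casts account for
   x ++ (y ++ z) = (x ++ y) ++ z and x ++ [::] = x, which do not hold
   definitionally. *)
Inductive mor_eq : forall x y, mor x y -> mor x y -> Prop :=
| meq_rel x y (f g : mor x y) : rel f g -> f =D g
| meq_refl x y (f : mor x y) : f =D f
| meq_sym x y (f g : mor x y) : f =D g -> g =D f
| meq_trans x y (f g h : mor x y) : f =D g -> g =D h -> f =D h
| meq_comp x y z (g g' : mor y z) (f f' : mor x y) :
    g =D g' -> f =D f' -> g \oD f =D g' \oD f'
| meq_tens x y z t (f f' : mor x y) (g g' : mor z t) :
    f =D f' -> g =D g' -> f \xD g =D f' \xD g'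
| meq_add x y (f f' g g' : mor x y) :
    f =D f' -> g =D g' -> Add f g =D Add f' g'
| meq_scale x y a (f f' : mor x y) : f =D f' -> Scale a f =D Scale a f'
(* k-vector spaces *)
| meq_addA x y (f g h : mor x y) : Add f (Add g h) =D Add (Add f g) h
| meq_addC x y (f g : mor x y) : Add f g =D Add g f
| meq_add0 x y (f : mor x y) : Add Zero f =D f
| meq_addN x y (f : mor x y) : Add (Scale (- 1) f) f =D Zero
| meq_scale1 x y (f : mor x y) : Scale 1 f =D f
| meq_scaleA x y a b (f : mor x y) : Scale a (Scale b f) =D Scale (a * b) f
| meq_scaleDl x y a b (f : mor x y) :
    Scale (a + b) f =D Add (Scale a f) (Scale b f)
| meq_scaleDr x y a (f g : mor x y) :
    Scale a (Add f g) =D Add (Scale a f) (Scale a g)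
(* bilinearity of composition and of the tensor product *)
| meq_compDl x y z (g g' : mor y z) (f : mor x y) :
    Add g g' \oD f =D Add (g \oD f) (g' \oD f)
| meq_compDr x y z (g : mor y z) (f f' : mor x y) :
    g \oD Add f f' =D Add (g \oD f) (g \oD f')
| meq_compZl x y z a (g : mor y z) (f : mor x y) :
    Scale a g \oD f =D Scale a (g \oD f)
| meq_compZr x y z a (g : mor y z) (f : mor x y) :
    g \oD Scale a f =D Scale a (g \oD f)
| meq_tensDl x y z t (f f' : mor x y) (g : mor z t) :
    Add f f' \xD g =D Add (f \xD g) (f' \xD g)
| meq_tensDr x y z t (f : mor x y) (g g' : mor z t) :
    f \xD Add g g' =D Add (f \xD g) (f \xD g')
| meq_tensZl x y z t a (f : mor x y) (g : mor z t) :
    Scale a f \xD g =D Scale a (f \xD g)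
| meq_tensZr x y z t a (f : mor x y) (g : mor z t) :
    f \xD Scale a g =D Scale a (f \xD g)
(* strict monoidal category *)
| meq_compA x y z t (h : mor z t) (g : mor y z) (f : mor x y) :
    h \oD (g \oD f) =D (h \oD g) \oD f
| meq_comp1l x y (f : mor x y) : Id y \oD f =D f
| meq_comp1r x y (f : mor x y) : f \oD Id x =D f
| meq_tens1 x y : Id x \xD Id y =D Id (x ++ y)
| meq_interchange x y z x' y' z'
    (g : mor y z) (f : mor x y) (g' : mor y' z') (f' : mor x' y') :
    (g \oD f) \xD (g' \oD f') =D (g \xD g') \oD (f \xD f')
| meq_tensA x y x' y' x'' y''
    (f : mor x y) (g : mor x' y') (h : mor x'' y'') :
    castm (catA x x' x'') (catA y y' y'') (f \xD (g \xD h)) =D (f \xD g) \xD h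
| meq_unitl x y (f : mor x y) : Id [::] \xD f =D f
| meq_unitr x y (f : mor x y) : castm (cats0 x) (cats0 y) (f \xD Id [::]) =D f
where "f =D g" := (mor_eq f g).

End DiagrammaticCategory.

Arguments mor k {n} x y.

Notation "g \oD f" := (Comp g f) : diag_scope.
Notation "f \xD g" := (Tens f g) : diag_scope.
Notation "f =D g" := (mor_eq f g) : diag_scope.

Section Paths.
Variable n : nat.
Local Notation I := 'I_n.
Implicit Types (x y z u v : seq I) (i j : I).

(* Edges of the expanded expression graph, together with a direction of
   traversal: [edge x y] is an edge traversed from x to y. *)
Inductive edge : seq I -> seq I -> Type :=
| DistantEdge u i j v of distant i j :
    edge (u ++ [:: i; j] ++ v) (u ++ [:: j; i] ++ v)
| AdjacentEdge u i j v of adjacent i j :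
    edge (u ++ [:: i; j; i] ++ v) (u ++ [:: j; i; j] ++ v).

Definition rev_edge x y (e : edge x y) : edge y x :=
  match e in edge a b return edge b a with
  | DistantEdge u i j v d => DistantEdge u v (distant_sym d)
  | AdjacentEdge u i j v a => AdjacentEdge u v (adjacent_sym a)
  end.

Definition along_orientation x y (e : edge x y) : bool :=
  match e with
  | DistantEdge _ _ _ _ _ => true
  | AdjacentEdge _ i j _ _ => j == i.+1 :> nat
  end.

Inductive expr_path (w : 'S_n.+1) : seq I -> seq I -> Type :=
| PathNil x of reduced w x : expr_path w x x
| PathCons x y z of reduced w x & edge x y & expr_path w y z : expr_path w x z.

Fixpoint path_rcons w x y z (p : expr_path w x y) :
    edge y z -> reduced w z -> expr_path w x z :=
  match p in expr_path _ a b return edge b z -> reduced w z -> expr_path w a z with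
  | PathNil _ hx => fun e hz => PathCons hx e (PathNil hz)
  | PathCons _ _ _ hx e' q => fun e hz => PathCons hx e' (path_rcons q e hz)
  end.

Fixpoint path_rev w x y (p : expr_path w x y) : expr_path w y x :=
  match p in expr_path _ a b return expr_path w b a with
  | PathNil _ hx => PathNil hx
  | PathCons _ _ _ hx e q => path_rcons (path_rev q) (rev_edge e) hx
  end.

Fixpoint oriented w x y (p : expr_path w x y) : bool :=
  match p with
  | PathNil _ _ => true
  | PathCons _ _ _ _ e q => along_orientation e && oriented q
  end.

Definition reverse_oriented w x y (p : expr_path w x y) : bool :=
  oriented (path_rev p).

Variable k : fieldType.

Definition edge_mor x y (e : edge x y) : mor k x y :=
  match e in edge a b return mor k a b with
  | DistantEdge u i j v d => whisker u v (X4 k d)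
  | AdjacentEdge u i j v a => whisker u v (T6 k a)
  end.

Fixpoint path_mor w x y (p : expr_path w x y) : mor k x y :=
  match p in expr_path _ a b return mor k a b with
  | PathNil x _ => Id k x
  | PathCons _ _ _ _ e q => Comp (path_mor q) (edge_mor e)
  end.

Lemma path_mor_degree w x y (p : expr_path w x y) : has_degree (path_mor p) 0.
Proof.
elim: p => [z _|a b c _ e q IHq] /=; first exact: DegId.
rewrite -[0]addr0; apply: DegComp IHq _; rewrite -[0]addr0.
by case: e => u i j v h; apply: DegTens (DegId k u) _;
  rewrite -[0]addr0; apply: DegTens (DegGen k _) (DegId k v).
Qed.

End Paths.

Arguments path_mor {n} k {w x y} p.

(* Main.v *)
Require Import Defs.
From mathcomp Require Import all_boot all_order all_fingroup all_algebra.
From mathcomp Require Import mpoly.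
From mathcomp Require Import zify.

Set Implicit Arguments.
Unset Strict Implicit.
Unset Printing Implicit Defensive.

Local Open Scope diag_scope.

(* Induction on the length of the words.  Let f : x -> y be an oriented path and
   write y = t y'.  The letter t in front of y is the crossing of two wires that
   are adjacent at the start, and this crossing sits somewhere inside x.  There
   is a canonical oriented path c_x : x -> t x' which pulls it to the front.  The
   path c_x depends on x only, and it is natural: for an oriented edge
   e : x -> x1 there is an oriented path h : x' -> x1' with c_x1 e = (t h) c_x.
   Hence f = (t f') c_x for an oriented path f' : x' -> y', and two paths with
   the same ends are equal by the induction hypothesis applied to x' -> y'.

   To define c_x, read x from the right.  Once the crossing has been met, the
   part of x already read is replaced by E z, where the staircase
   E = (j + m) ... (j + 1) j crosses the upper of the two wires with the m wires
   lying between them and then the two wires.  A letter t in front of E is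
   absorbed by at most one 6-valent vertex.  Naturality is checked on the edges
   at the front of a word: a distant edge needs X X = 1 and naturality of the
   4-valent vertices, an adjacent edge needs in addition the Zamolodchikov
   relation.  The single configuration where an adjacent edge cannot be lifted
   would make two wires cross twice. *)

(** * Morphisms up to reassociation of objects *)

Section Heterogeneous.
Variables (k : fieldType) (n : nat).
Local Notation I := 'I_n.
Local Notation mor := (@mor k n).
Implicit Types (x y z t u v : seq I) (i j : I).

(** Associativity and the right unit of concatenation hold only up to propositional equality of
    words. Hiding the casts under an existential lets morphisms with differently bracketed ends be
    compared directly. *)
Definition heq x y x' y' (f : mor x y) (g : mor x' y') : Prop :=
  exists (ex : x = x') (ey : y = y'), castm ex ey f =D g.

Lemma heq_meq x y (f g : mor x y) : f =D g -> heq f g.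
Proof. by exists erefl, erefl. Qed.

Lemma meq_heq x y (f g : mor x y) : heq f g -> f =D g.
Proof. by case=> ex [ey]; rewrite castm_id. Qed.

Lemma heq_refl x y (f : mor x y) : heq f f.
Proof. exact/heq_meq/meq_refl. Qed.

Lemma heq_sym x y x' y' (f : mor x y) (g : mor x' y') : heq f g -> heq g f.
Proof. by case=> ex [ey]; case: _ / ex g; case: _ / ey => g /meq_sym/heq_meq. Qed.

Lemma heq_trans x y x' y' x'' y''
    (f : mor x y) (g : mor x' y') (h : mor x'' y'') :
  heq f g -> heq g h -> heq f h.
Proof.
case=> ex [ey]; case: _ / ex g; case: _ / ey => g /= fg.
case=> ex [ey]; case: _ / ex h; case: _ / ey => h /= gh.
exact: heq_meq (meq_trans fg gh).
Qed.

Lemma heq_cast x y x' y' (ex : x = x') (ey : y = y') (f : mor x y) :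
  heq f (castm ex ey f).
Proof. by exists ex, ey; apply: meq_refl. Qed.

Lemma heq_comp x y z x' y' z'
    (g : mor y z) (f : mor x y) (g' : mor y' z') (f' : mor x' y') :
  heq g g' -> heq f f' -> heq (g \oD f) (g' \oD f').
Proof.
case=> ey [ez]; case: _ / ey g' f'; case: _ / ez => g' f' gg'.
case=> ex [ey]; case: _ / ex f' => f'; rewrite (eq_irrelevance ey erefl) => ff'.
exact/heq_meq/meq_comp.
Qed.

Lemma heq_tens x y z t x' y' z' t'
    (f : mor x y) (g : mor z t) (f' : mor x' y') (g' : mor z' t') :
  heq f f' -> heq g g' -> heq (f \xD g) (f' \xD g').
Proof.
case=> ex [ey]; case: _ / ex f'; case: _ / ey => f' ff'.
case=> ex [ey]; case: _ / ex g'; case: _ / ey => g' gg'.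
exact/heq_meq/meq_tens.
Qed.

Lemma heq_tensA x y x' y' x'' y''
    (f : mor x y) (g : mor x' y') (h : mor x'' y'') :
  heq (f \xD (g \xD h)) ((f \xD g) \xD h).
Proof. by exists (catA _ _ _), (catA _ _ _); apply: meq_tensA. Qed.

Lemma heq_unitr x y (f : mor x y) : heq (f \xD Id k [::]) f.
Proof. by exists (cats0 _), (cats0 _); apply: meq_unitr. Qed.

Lemma heq_unitl x y (f : mor x y) : heq (Id k [::] \xD f) f.
Proof. exact/heq_meq/meq_unitl. Qed.

Lemma heq_whisker a b x y x' y' (f : mor x y) (g : mor x' y') :
  heq f g -> heq (whisker a b f) (whisker a b g).
Proof.
by move=> fg; apply: heq_tens (heq_refl _) (heq_tens fg (heq_refl _)).
Qed.

Lemma heq_whisker_whisker a b u v x y (f : mor x y) :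
  heq (whisker a b (whisker u v f)) (whisker (a ++ u) (v ++ b) f).
Proof.
rewrite /whisker.
apply: heq_trans (_ : heq _ (Id k a \xD (Id k u \xD (f \xD (Id k v \xD Id k b))))) _.
  apply: heq_tens (heq_refl _) _; apply: heq_sym.
  apply: heq_trans _ (heq_tensA _ _ _).
  exact: heq_tens (heq_refl _) (heq_tensA _ _ _).
apply: heq_trans (heq_tensA _ _ _) _.
apply: heq_tens (heq_meq (meq_tens1 _ _ _)) _.
exact: heq_tens (heq_refl _) (heq_meq (meq_tens1 _ _ _)).
Qed.

Lemma whisker_comp a b x y z (g : mor y z) (f : mor x y) :
  whisker a b (g \oD f) =D whisker a b g \oD whisker a b f.
Proof.
apply: meq_trans (_ : _ =D (Id k a \oD Id k a) \xD ((g \oD f) \xD (Id k b \oD Id k b))) _.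
  apply: meq_tens; first exact/meq_sym/meq_comp1l.
  by apply: meq_tens; [apply: meq_refl | apply/meq_sym/meq_comp1l].
apply: meq_trans (meq_interchange _ _ _ _).
by apply: meq_tens; [apply: meq_refl | apply: meq_interchange].
Qed.

Lemma whisker_Id a b x : whisker a b (Id k x) =D Id k (a ++ x ++ b).
Proof.
by apply: meq_trans (meq_tens1 _ _ _); apply: meq_tens;
  [apply: meq_refl | apply: meq_tens1].
Qed.

Lemma comp_tens_whiskers x y z t (f : mor x y) (g : mor z t) :
  (Id k y \xD g) \oD (f \xD Id k z) =D f \xD g.
Proof.
apply: meq_trans (meq_sym (meq_interchange _ _ _ _)) _.
by apply: meq_tens; [apply: meq_comp1l | apply: meq_comp1r].
Qed.

Lemma comp_whiskers_tens x y z t (f : mor x y) (g : mor z t) :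
  (f \xD Id k t) \oD (Id k x \xD g) =D f \xD g.
Proof.
apply: meq_trans (meq_sym (meq_interchange _ _ _ _)) _.
by apply: meq_tens; [apply: meq_comp1r | apply: meq_comp1l].
Qed.

End Heterogeneous.

(** * Paths as lists of layers *)

Section Layers.
Variable n : nat.
Local Notation I := 'I_n.
Implicit Types (x y z t u v : seq I) (i j : I).

(** A vertex is stored by its indices alone, without a proof of distance or adjacency, so that lists
    of layers can be compared as plain data. *)
Inductive kind := KX of I & I | KT of I & I.
Definition ksrc K := match K with KX i j => [:: i; j] | KT i j => [:: i; j; i] end.
Definition ktgt K := match K with KX i j => [:: j; i] | KT i j => [:: j; i; j] end.
(* 6-valent vertices are only allowed along the orientation. *)
Definition kok K :=
  match K with KX i j => distant i j | KT i j => j == i.+1 :> nat end.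

Definition layer : Type := seq I * kind * seq I.
Implicit Types (l : layer) (L : seq layer).
Definition lsrc l := l.1.1 ++ ksrc l.1.2 ++ l.2.
Definition ltgt l := l.1.1 ++ ktgt l.1.2 ++ l.2.

Definition wl u l v : layer := (u ++ l.1.1, l.1.2, l.2 ++ v).
Definition wh u L v : seq layer := [seq wl u l v | l <- L].

Fixpoint opath x L y : bool :=
  if L is l :: L' then [&& x == lsrc l, kok l.1.2 & opath (ltgt l) L' y]
  else x == y.

Lemma wh_cat u v L L' : wh u (L ++ L') v = wh u L v ++ wh u L' v.
Proof. exact: map_cat. Qed.

Lemma wh_wh u v u' v' L : wh u (wh u' L v') v = wh (u ++ u') L (v' ++ v).
Proof. by rewrite /wh -map_comp; apply: eq_map => l; rewrite /wl /= !catA. Qed.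

Lemma wh00 L : wh [::] L [::] = L.
Proof. by rewrite -[RHS]map_id; apply: eq_map => -[[u K] v]; rewrite /wl /= cats0. Qed.

Lemma opath_cat x y z L L' : opath x L y -> opath y L' z -> opath x (L ++ L') z.
Proof.
by elim: L x => [|l L IH] x /= => [/eqP-> // | /and3P[-> -> /IH h] /h].
Qed.

Lemma lsrc_wl u l v : lsrc (wl u l v) = u ++ lsrc l ++ v.
Proof. by rewrite /lsrc /= -!catA. Qed.

Lemma ltgt_wl u l v : ltgt (wl u l v) = u ++ ltgt l ++ v.
Proof. by rewrite /ltgt /= -!catA. Qed.

Lemma opath_wh u v x y L : opath x L y -> opath (u ++ x ++ v) (wh u L v) (u ++ y ++ v).
Proof.
elim: L x => [|l L IH] x /= => [/eqP-> // | /and3P[/eqP-> -> /IH]].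
by rewrite lsrc_wl ltgt_wl eqxx.
Qed.

Lemma opath_size x y L : opath x L y -> size x = size y.
Proof.
elim: L x => [|l L IH] x /= => [/eqP-> // | /and3P[/eqP-> _ /IH <-]].
by rewrite !size_cat; case: l => [[u [i j|i j]] v].
Qed.

End Layers.

(** * Morphisms represented by lists of layers *)

Section Semantics.
Variables (k : fieldType) (n : nat).
Local Notation I := 'I_n.
Local Notation mor := (@mor k n).
Implicit Types (x y z t u v : seq I) (i j : I) (l : layer n) (L : seq (layer n)).

(* The junk value Zero is ruled out by [kok]. *)
Definition kmor (K : kind n) : mor (ksrc K) (ktgt K) :=
  match K return mor (ksrc K) (ktgt K) with
  | KX i j => if @idP (distant i j) is ReflectT d then X4 k d else Zero k _ _
  | KT i j => if @idP (adjacent i j) is ReflectT a then T6 k a else Zero k _ _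
  end.

Lemma kmorX i j (d : distant i j) : kmor (KX i j) = X4 k d.
Proof. by rewrite /=; case: {-}_ / idP => // d'; rewrite (bool_irrelevance d' d). Qed.

Lemma kmorT i j (a : adjacent i j) : kmor (KT i j) = T6 k a.
Proof. by rewrite /=; case: {-}_ / idP => // d'; rewrite (bool_irrelevance d' a). Qed.

Definition lmor l : mor (lsrc l) (ltgt l) := whisker l.1.1 l.2 (kmor l.1.2).

(** A relation rather than a function: the target of a layer and the source of the next one agree
    only propositionally, so an actual composite would carry a cast at each step. *)
Fixpoint sem L x y (f : mor x y) : Prop :=
  if L is l :: L' then
    exists2 g : mor (ltgt l) y, sem L' g & heq f (g \oD lmor l)
  else heq f (Id k x).

Lemma sem_heq L x y x' y' (f : mor x y) (g : mor x' y') :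
  heq f g -> sem L f -> sem L g.
Proof.
case=> ex [ey]; case: _ / ex g; case: _ / ey => g /= /meq_sym/heq_meq gf.
case: L => [|l L] /=; first exact: heq_trans.
by case=> h Lh fh; exists h => //; apply: heq_trans fh.
Qed.

Lemma sem_fun L x y (f g : mor x y) : sem L f -> sem L g -> f =D g.
Proof.
elim: L x f g => [|l L IH] x f g /=.
  by move=> fI gI; apply: meq_heq; apply: heq_trans fI (heq_sym gI).
case=> f' Lf' ff' [g' Lg' gg']; apply: meq_heq; apply: heq_trans ff' _.
apply: heq_trans (heq_sym gg'); apply: heq_comp (heq_refl _).
exact/heq_meq/IH.
Qed.

Lemma sem_cat L L' x y z (f : mor x y) (g : mor y z) :
  sem L f -> sem L' g -> sem (L ++ L') (g \oD f).
Proof.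
elim: L x f => [|l L IH] x f /=.
  case=> ex [ey]; subst x; rewrite castm_id => fI.
  apply: sem_heq; apply: heq_meq; apply: meq_sym.
  apply: meq_trans (meq_comp1r g); exact: meq_comp (meq_refl _) fI.
case=> h Lh fh Lg; exists (g \oD h); first exact: IH.
apply: heq_trans (heq_comp (heq_refl _) fh) _.
exact/heq_meq/meq_compA.
Qed.

Lemma sem_wh L u v x y (f : mor x y) : sem L f -> sem (wh u L v) (whisker u v f).
Proof.
elim: L x f => [|l L IH] x f /=.
  case=> ex [ey]; subst x; rewrite castm_id => fI.
  apply: heq_trans (heq_whisker _ _ (heq_meq fI)) _.
  exact/heq_meq/whisker_Id.
case=> g Lg fg.
exists (castm (esym (ltgt_wl u l v)) erefl (whisker u v g)).
  apply: sem_heq (heq_cast _ _ _) _; exact: IH.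
apply: heq_trans (heq_whisker _ _ fg) _.
apply: heq_trans (heq_meq (whisker_comp _ _ _ _)) _.
apply: heq_comp (heq_cast _ _ _) _; exact: heq_whisker_whisker.
Qed.

Lemma sem_layer l : sem [:: l] (lmor l).
Proof. exists (Id k _); [exact: heq_refl | exact/heq_meq/meq_sym/meq_comp1l]. Qed.

Lemma opath_sem x L y : opath x L y -> exists f : mor x y, sem L f.
Proof.
elim: L x => [|l L IH] x /=.
  by move/eqP=> <-; exists (Id k x); apply: heq_refl.
by move=> /and3P[/eqP-> _ /IH[f Lf]]; exists (f \oD lmor l), f => //; apply: heq_refl.
Qed.

(** Equality in the category of the composites of two lists; by [sem_fun] the common morphism is
    unique up to [=D]. *)
Definition eqv x y L L' := exists2 f : mor x y, sem L f & sem L' f.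

Lemma eqv_refl x y L : opath x L y -> eqv x y L L.
Proof. by case/opath_sem=> f; exists f. Qed.

Lemma eqv_sym x y L L' : eqv x y L L' -> eqv x y L' L.
Proof. by case=> f; exists f. Qed.

Lemma eqv_trans x y L1 L2 L3 : eqv x y L1 L2 -> eqv x y L2 L3 -> eqv x y L1 L3.
Proof.
move=> [f h1 h2] [g h3 h4]; exists f => //; apply: sem_heq h4.
exact/heq_meq/(sem_fun h3).
Qed.

Lemma eqv_cat x y z L1 L2 L1' L2' :
  eqv x y L1 L1' -> eqv y z L2 L2' -> eqv x z (L1 ++ L2) (L1' ++ L2').
Proof. by move=> [f h1 h2] [g h3 h4]; exists (g \oD f); apply: sem_cat. Qed.

Lemma eqv_wh u v x y L L' :
  eqv x y L L' -> eqv (u ++ x ++ v) (u ++ y ++ v) (wh u L v) (wh u L' v).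
Proof. by move=> [f h1 h2]; exists (whisker u v f); apply: sem_wh. Qed.

(** Both orders represent the tensor product of the two morphisms. *)
Lemma eqv_interchange x y z t L L' : opath x L y -> opath z L' t ->
  eqv (x ++ z) (y ++ t) (wh [::] L z ++ wh y L' [::]) (wh x L' [::] ++ wh [::] L t).
Proof.
move=> /opath_sem[f Lf] /opath_sem[g Lg]; exists (f \xD g).
  apply: sem_heq (heq_meq (comp_tens_whiskers f g)) _; apply: sem_cat.
    exact: sem_heq (heq_unitl _) (sem_wh _ _ Lf).
  apply: sem_heq (sem_wh _ _ Lg).
  exact: heq_tens (heq_refl _) (heq_unitr _).
apply: sem_heq (heq_meq (comp_whiskers_tens f g)) _; apply: sem_cat.
  apply: sem_heq (sem_wh _ _ Lg).
  exact: heq_tens (heq_refl _) (heq_unitr _).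
exact: sem_heq (heq_unitl _) (sem_wh _ _ Lf).
Qed.

End Semantics.

(** * The defining relations as identities between lists of layers *)

Section Relations.
Variables (k : fieldType) (n : nat).
Local Notation I := 'I_n.
Local Notation mor := (@mor k n).
Local Notation eqv := (@eqv k n).
Implicit Types (x y z t u v : seq I) (i j l : I) (L : seq (layer n)) (K : kind n).

Lemma sem_layer_heq (l : layer n) x y (f : mor x y) : heq (lmor k l) f -> sem [:: l] f.
Proof. by move/sem_heq; apply; apply: sem_layer. Qed.

Lemma lmor_heql K v : heq (lmor k ([::], K, v)) (kmor k K \xD Id k v).
Proof. exact: heq_unitl. Qed.

Lemma lmor_heqr u K : heq (lmor k (u, K, [::])) (Id k u \xD kmor k K).
Proof. exact: heq_tens (heq_refl _) (heq_unitr _). Qed.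

Lemma lmor_heq K : heq (lmor k ([::], K, [::])) (kmor k K).
Proof. exact: heq_trans (lmor_heql _ _) (heq_unitr _). Qed.

Local Ltac layers :=
  first [ apply: sem_layer_heq;
          first [exact: lmor_heq | exact: lmor_heql | exact: lmor_heqr | exact: heq_refl]
        | apply: (@sem_cat _ _ [:: _] (_ :: _)); layers ].

Lemma eqv_XX i j : distant i j ->
  eqv [:: i; j] [:: i; j] [:: ([::], KX i j, [::]); ([::], KX j i, [::])] [::].
Proof.
move=> dij; have dji := distant_sym dij.
exists (X4 k dji \oD X4 k dij); last exact/heq_meq/meq_rel/rel_XX.
rewrite -!kmorX; layers.
Qed.

Lemma eqv_XXX i j l : distant i j -> distant i l -> distant j l ->
  eqv [:: i; j; l] [:: l; j; i]
    [:: ([::], KX i j, [:: l]); ([:: j], KX i l, [::]); ([::], KX j l, [:: i])]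
    [:: ([:: i], KX j l, [::]); ([::], KX i l, [:: j]); ([:: l], KX i j, [::])].
Proof.
move=> dij dil djl.
exists ((X4 k djl \xD Id k [:: i]) \oD (Id k [:: j] \xD X4 k dil)
         \oD (X4 k dij \xD Id k [:: l])).
  rewrite -!kmorX; layers.
have/heq_meq/heq_sym/sem_heq := meq_rel (@rel_XXX k _ i j l dij dil djl); apply.
rewrite -!kmorX; layers.
Qed.

Lemma eqv_XT i j l : adjacent i j -> distant i l -> distant j l ->
  eqv [:: i; j; i; l] [:: l; j; i; j]
    [:: ([::], KT i j, [:: l]); ([:: j; i], KX j l, [::]);
        ([:: j], KX i l, [:: j]); ([::], KX j l, [:: i; j])]
    [:: ([:: i; j], KX i l, [::]); ([:: i], KX j l, [:: i]);
        ([::], KX i l, [:: j; i]); ([:: l], KT i j, [::])].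
Proof.
move=> aij dil djl.
exists ((X4 k djl \xD Id k [:: i; j]) \oD (Id k [:: j] \xD X4 k dil \xD Id k [:: j])
         \oD (Id k [:: j; i] \xD X4 k djl) \oD (T6 k aij \xD Id k [:: l])).
  rewrite -!kmorX -kmorT; layers.
have/heq_meq/heq_sym/sem_heq := meq_rel (@rel_XT k _ i j l aij dil djl); apply.
rewrite -!kmorX -kmorT; layers.
Qed.

(** The Zamolodchikov relation makes two distant moves at the same height; here they are put in
    sequence, the left one first. *)
Lemma sem_two_layers x K u K' :
  sem [:: (x, K, u ++ ksrc K'); (x ++ ktgt K ++ u, K', [::])]
    (Id k x \xD kmor k K \xD Id k u \xD kmor k K').
Proof.
apply: sem_heq (_ : sem _ ((Id k x \xD (Id k (ktgt K) \xD (Id k u \xD kmor k K')))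
    \oD (Id k x \xD (kmor k K \xD Id k (u ++ ksrc K'))))); last first.
  apply: (@sem_cat _ _ [:: _] [:: _]); apply: sem_layer_heq; first exact: heq_refl.
  apply: heq_trans (lmor_heqr _ _) _; apply: heq_sym.
  apply: heq_trans (heq_tens (heq_refl _) (heq_tensA _ _ _)) _.
  apply: heq_trans (heq_tensA _ _ _) _; apply: heq_tens (heq_refl _).
  apply: heq_trans (heq_tens (heq_refl _) (heq_meq (meq_tens1 _ _ _))) _.
  exact: heq_meq (meq_tens1 _ _ _).
apply: heq_meq; apply: meq_trans (meq_sym (meq_interchange _ _ _ _)) _.
by apply: meq_tens; [apply: meq_comp1l | apply: comp_tens_whiskers].
Qed.

Lemma eqv_zam (a b c : I) : b = a.+1 :> nat -> c = b.+1 :> nat ->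
  eqv [:: a; b; a; c; b; a] [:: c; b; c; a; b; c]
    [:: ([::], KT a b, [:: c; b; a]); ([:: b; a], KT b c, [:: a]);
        ([:: b], KX a c, [:: b; c; a]); ([:: b; c; a; b], KX c a, [::]);
        ([:: b; c], KT a b, [:: c]); ([::], KT b c, [:: a; b; c])]
    [:: ([:: a; b], KX a c, [:: b; a]); ([:: a; b; c], KT a b, [::]);
        ([:: a], KT b c, [:: a; b]); ([::], KX a c, [:: b; c; a; b]);
        ([:: c; a; b], KX c a, [:: b]); ([:: c], KT a b, [:: c; b]);
        ([:: c; b; a], KT b c, [::]); ([:: c; b], KX a c, [:: b; c])].
Proof.
move=> eb ec.
have ab : adjacent a b by rewrite /adjacent; lia.
have bc : adjacent b c by rewrite /adjacent; lia.
have ac : distant a c by rewrite /distant; lia.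
have ca := distant_sym ac.
have/heq_meq/heq_sym/sem_heq R :=
  meq_rel (@rel_zam k _ a b c eb ec ab bc ac ca).
move: R; rewrite -!kmorX -!kmorT => R.
eexists; last apply: R.
  do 2!(apply: (@sem_cat _ _ [:: _] (_ :: _)); first layers).
  apply: (@sem_cat _ _ [:: _; _] (_ :: _)); last layers.
  exact: (@sem_two_layers [:: b] (KX a c) [:: b] (KX c a)).
do 3!(apply: (@sem_cat _ _ [:: _] (_ :: _)); first layers).
apply: (@sem_cat _ _ [:: _; _] (_ :: _)); last layers.
(* On this side a further strand [b] stands to the right of the two simultaneous crossings. *)
apply: sem_heq (_ : sem _ (whisker [::] [:: b]
  (Id k [::] \xD kmor k (KX a c) \xD Id k [:: b] \xD kmor k (KX c a)))); last first.
  exact: (sem_wh [::] [:: b] (@sem_two_layers [::] (KX a c) [:: b] (KX c a))).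
apply: heq_trans (heq_unitl _) _.
apply: heq_trans (heq_tens (heq_unitl _) (heq_refl _)) _.
apply: heq_trans (heq_sym (heq_tensA _ _ _)) _.
exact: heq_tens (heq_refl _) (heq_sym (heq_tensA _ _ _)).
Qed.

End Relations.

(** * Sliding letters past distant words *)

Section Slides.
Variable n : nat.
Local Notation I := 'I_n.
Implicit Types (x y z t u v U V D E : seq I) (i j a b c e : I) (L : seq (layer n)) (K :
    kind n).

Lemma wh_nil u v : wh u [::] v = [::] :> seq (layer n). Proof. by []. Qed.
Lemma wh_cons u v x K y L :
  wh u ((x, K, y) :: L) v = (u ++ x, K, y ++ v) :: wh u L v.
Proof. by []. Qed.

Lemma wlE u v x K y : wl u (x, K, y) v = (u ++ x, K, y ++ v) :> layer n.
Proof. by []. Qed.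

(* [slide i D] is the path i D -> D i, [slide_back U e] is U e -> e U and
   [slide_word U D] is U D -> D U; [hop a b E1 E3], for b = a + 1, is
   a E1 b a E3 -> E1 a b a E3 -> E1 b a b E3 -> E1 b a E3 b. *)
Fixpoint slide i D : seq (layer n) :=
  if D is e :: D' then ([::], KX i e, D') :: wh [:: e] (slide i D') [::] else [::].

Fixpoint slide_back U e : seq (layer n) :=
  if U is i :: U' then rcons (wh [:: i] (slide_back U' e) [::]) ([::], KX i e, U') else
      [::].

Fixpoint slide_word U D : seq (layer n) :=
  if D is e :: D' then wh [::] (slide_back U e) D' ++ wh [:: e] (slide_word U D') [::]
      else [::].

Definition hop a b E1 E3 : seq (layer n) :=
  wh [::] (slide a E1) (b :: a :: E3) ++
  (E1, KT a b, E3) :: wh (E1 ++ [:: b; a]) (slide b E3) [::].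

End Slides.
#[global] Arguments wh : simpl never.
#[global] Arguments hop : simpl never.
(* Normal form of a list of layers: whiskers are pushed inwards and
   concatenations are associated to the right. *)
Ltac normalize := rewrite -?cats1 ?(wh_cat, wh_cons, wh_nil, wh_wh, wh00, wlE) /=
    -?catA /= -?catA /= -?catA /= ?cats0 /= ?cats0.
Ltac by_normalize := by normalize.

Section SlideLemmas.
Variable n : nat.
Local Notation I := 'I_n.
Implicit Types (x y z t u v U V D E : seq I) (i j a b c e : I) (L : seq (layer n)) (K :
    kind n).

Lemma slide_cat i D D' : slide i (D ++ D') = wh [::] (slide i D) D' ++
    wh D (slide i D') [::].
Proof. by elim: D => [|e D IH] /=; [normalize|rewrite IH; normalize]. Qed.

Lemma slide_back_cat U U' e : slide_back (U ++ U') e = wh U (slide_back U' e) [::] ++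
    wh [::] (slide_back U e) U'.
Proof. by elim: U => [|i U IH] /=; [normalize | rewrite IH -!cats1; normalize]. Qed.

Lemma opathw u v x y L x' y' : opath x L y -> u ++ x ++ v = x' -> u ++ y ++ v = y' ->
  opath x' (wh u L v) y'.
Proof. by move=> h <- <-; apply: opath_wh. Qed.

Lemma opathl u K v x' y' : kok K -> u ++ ksrc K ++ v = x' -> u ++ ktgt K ++ v = y' ->
  opath x' [:: (u, K, v)] y'.
Proof. by move=> h <- <- /=; rewrite h /lsrc /ltgt /= !eqxx. Qed.

Lemma opathk K : kok K -> opath (ksrc K) [:: ([::], K, [::])] (ktgt K).
Proof. by move=> h; apply: opathl; rewrite //= cats0. Qed.

Lemma opath_cons u K v x y z L :
  opath x [:: (u, K, v)] y -> opath y L z -> opath x ((u, K, v) :: L) z.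
Proof. exact: (@opath_cat _ _ _ _ [:: _]). Qed.

Lemma opath_slide i D : all (distant i) D -> opath (i :: D) (slide i D) (D ++ [:: i]).
Proof.
elim: D => [|e D IH] //= /andP[ie /IH h].
by rewrite ie eqxx; apply: opathw h _ _; normalize.
Qed.

Lemma opath_slide_back U e : all (distant e) U -> opath (U ++
    [:: e]) (slide_back U e) (e :: U).
Proof.
elim: U => [|i U IH] //= /andP[/distant_sym ei /IH h]; rewrite -cats1.
apply: (opath_cat (y := i :: e :: U)); first by apply: opathw h _ _; normalize.
exact: opathl.
Qed.

Lemma opath_slide_word U D : all (fun e => all (distant e) U) D -> opath (U ++
    D) (slide_word U D) (D ++ U).
Proof.
elim: D => [|e D IH] /=; first by rewrite cats0.
case/andP=> eU /IH h; apply: (opath_cat (y := e :: U ++ D)).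
  by apply: opathw (opath_slide_back eU) _ _; normalize.
by apply: opathw h _ _; normalize.
Qed.

Lemma opath_hop a b E1 E3 : b = a.+1 :> nat -> all (distant a) E1 -> all (distant b) E3 ->
  opath (a :: E1 ++ b :: a :: E3) (hop a b E1 E3) (E1 ++ b :: a :: E3 ++ [:: b]).
Proof.
move=> ab aE bE; apply: (opath_cat (y := E1 ++ a :: b :: a :: E3)).
  by apply: opathw (opath_slide aE) _ _; normalize.
apply: (opath_cons (y := E1 ++ b :: a :: b :: E3)); first by apply: opathl;
    rewrite /= ?ab.
by apply: opathw (opath_slide bE) _ _; normalize.
Qed.

(** Both sides of a move use the same letters; hence being distant from a letter is inherited along
    a path. *)
Lemma opath_all (P : pred I) x y L : opath x L y -> all P x = all P y.
Proof.
elim: L x => [|[[u K] v] L IH] x /=; first by move/eqP=> ->.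
case/and3P=> /eqP-> _ /IH <-; rewrite !all_cat; congr (_ && (_ && _)).
by case: K => i j /=; rewrite !andbT; case: (P i); case: (P j).
Qed.

End SlideLemmas.

Ltac all_auto := first [eassumption | by rewrite /= ?(all_cat, all_rcons) /= ?all_cat
    /= ?andbT; do ?[by [] | apply/andP; split]].

Lemma opath_eq n (x y x' y' : seq 'I_n) L : opath x L y -> x = x' -> y = y' ->
    opath x' L y'.
Proof. by move=> h <- <-. Qed.

Ltac opath_block :=
  lazymatch goal with
  | |- is_true (opath _ (slide _ _) _) => apply: opath_slide; all_auto
  | |- is_true (opath _ (slide_back _ _) _) => apply: opath_slide_back; all_auto
  | |- is_true (opath _ (slide_word _ _) _) => apply: opath_slide_word; all_auto
  | |- is_true (opath _ (hop _ _ _ _) _) => apply: opath_hop; all_auto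
  | |- _ => eassumption
  end.
Ltac opath_chain :=
  lazymatch goal with
  | |- is_true (opath _ [::] _) => by rewrite /= ?cats0 -?catA /= ?cats0 ?eqxx
  | |- is_true (opath _ (_ ++ _) _) => eapply opath_cat; [opath_chain | opath_chain]
  | |- is_true (opath _ [:: _] _) =>
      eapply opathl; [first [by rewrite //= | exact: distant_sym] | by_normalize
          | by_normalize]
  | |- is_true (opath _ (_ :: _) _) => eapply opath_cons; [opath_chain | opath_chain]
  | |- is_true (opath _ (wh _ _ _) _) => eapply opathw; [opath_block | by_normalize
      | by_normalize]
  | |- _ => eapply opath_eq; [opath_block | by_normalize | by_normalize]
  end.

Ltac opath_auto := first [opath_chain | rewrite ?(wh_cat, wh_cons, wh_nil, wh_wh);
    opath_chain].

(** * Rewriting at one place of a path *)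

Section EqvRewriting.
Variables (k : fieldType) (n : nat).
Local Notation I := 'I_n.
Local Notation eqv := (@eqv k n).
Implicit Types (x y z t u v U V D E : seq I) (i j a b c e : I) (L M : seq (layer n)) (K
    : kind n).

Lemma eqv_conv x y L M x' y' L' M' : eqv x y L M ->
  x = x' -> y = y' -> L = L' -> M = M' -> eqv x' y' L' M'.
Proof. by move=> h <- <- <- <-. Qed.

(** The words [u], [v] stand beside the rewritten factor, the layers [A], [B] come before and after
    it. *)
Lemma eqv_ctx u v A B y z M M' x t L L' : eqv y z M M' ->
  opath x A (u ++ y ++ v) -> opath (u ++ z ++ v) B t ->
  A ++ wh u M v ++ B = L -> A ++ wh u M' v ++ B = L' -> eqv x t L L'.
Proof.
move=> h hA hB <- <-; apply: eqv_cat (eqv_refl _ hA) _.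
exact: eqv_cat (eqv_wh _ _ h) (eqv_refl _ hB).
Qed.

Lemma eqv_swap m x y z t L L' : opath x L y -> opath z L' t ->
  eqv (x ++ m ++ z) (y ++ m ++ t) (wh [::] L (m ++ z) ++ wh (y ++ m) L' [::])
    (wh (x ++ m) L' [::] ++ wh [::] L (m ++ t)).
Proof.
move=> h h'; have := eqv_interchange k h (opath_wh m [::] h').
by move/eqv_conv; apply; normalize.
Qed.

Lemma eqv_step u v A B y z M M' x t L N : eqv y z M M' ->
  opath x A (u ++ y ++ v) -> opath (u ++ z ++ v) B t ->
  A ++ wh u M v ++ B = L -> eqv x t (A ++ wh u M' v ++ B) N -> eqv x t L N.
Proof. by move=> h hA hB e; apply: eqv_trans; apply: eqv_ctx h hA hB e erefl. Qed.


End EqvRewriting.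

(** [step] rewrites one factor by [H] and leaves the remaining equation; [close] ends a chain of
    such rewritings. *)
Ltac step u v A B H :=
  apply: (eqv_step (u := u) (v := v) (A := A) (B := B) H);
  [opath_auto | opath_auto | by_normalize | normalize].

Ltac close u v A B H :=
  apply: (eqv_ctx (u := u) (v := v) (A := A) (B := B) H);
  [opath_auto | opath_auto | by_normalize | by_normalize].

(** * Invertibility and naturality of slides *)

Section SlideRelations.
Variables (k : fieldType) (n : nat).
Local Notation I := 'I_n.
Local Notation eqv := (@eqv k n).
Implicit Types (x y z t u v U V D E : seq I) (i j a b c e : I) (L M : seq (layer n)) (K
    : kind n).

Lemma slide_slide_back e U : all (distant e) U -> eqv (e :: U) (e :: U) (slide e U ++
    slide_back U e) [::].
Proof.
elim: U => [|i U IH] /=; first by move=> _; apply: eqv_refl => /=.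
case/andP=> ei eU; rewrite -cats1.
apply: eqv_trans (_ : eqv _ _ ([:: ([::], KX e i, U); ([::], KX i e, U)]) _); last first.
  by apply: eqv_conv (eqv_wh [::] U (eqv_XX k ei)) _ _ _ _; normalize.
apply: (eqv_ctx (u := [:: i]) (v := [::]) (A := [:: ([::], KX e i, U)])
  (B := [:: ([::], KX i e, U)]) (IH eU)); try by_normalize.
  by opath_chain.
by opath_chain.
Qed.

Lemma slide_back_slide e U : all (distant e) U ->
  eqv (U ++ [:: e]) (U ++ [:: e]) (slide_back U e ++ slide e U) [::].
Proof.
elim: U => [|i U IH] /=; first by move=> _; apply: eqv_refl => /=.
case/andP=> /[dup] ei /distant_sym ie eU.
apply: eqv_trans (_ : eqv _ _ (wh [:: i] (slide_back U e ++ slide e U) [::]) _);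
    last first.
  by apply: eqv_conv (eqv_wh [:: i] [::] (IH eU)) _ _ _ _; normalize.
apply: (eqv_ctx (u := [::]) (v := U) (A := wh [:: i] (slide_back U e) [::])
  (B := wh [:: i] (slide e U) [::]) (eqv_XX k ie)); normalize => //; opath_chain.
Qed.

(** For a single vertex this is the relation of three mutually distant strands, or the sliding of a
    strand past a 6-valent vertex. *)
Lemma slide_back_nat1 K e : kok K -> all (distant e) (ksrc K) ->
  eqv (ksrc K ++ [:: e]) (e :: ktgt K) (wh [::] [:: ([::], K, [::])] [:: e] ++
      slide_back (ktgt K) e)
     (slide_back (ksrc K) e ++ wh [:: e] [:: ([::], K, [::])] [::]).
Proof.
case: K => i j /= ij; rewrite ?andbT.
  by case/andP=> /distant_sym ie /distant_sym je; apply: eqv_XXX.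
case/and3P=> /distant_sym ie /distant_sym je _; apply: eqv_XT => //.
by rewrite /adjacent (eqP ij) eqxx.
Qed.

Lemma slide_back_nat e U L V : all (distant e) U -> opath U L V ->
  eqv (U ++ [:: e]) (e :: V) (wh [::] L [:: e] ++ slide_back V e) (slide_back U e ++
      wh [:: e] L [::]).
Proof.
elim: L U => [|[[u K] v] L IH] U /= => [eU /eqP<- | eU].
  by normalize; apply/eqv_refl/opath_slide_back.
move=> /= /and3P[/eqP eU' kK LV]; rewrite /lsrc /ltgt /= in eU' LV; subst U.
have eW : all (distant e) (u ++ ktgt K ++ v).
  by rewrite -(opath_all _ (opathl (u := u) (v := v) kK erefl erefl)).
have eV : all (distant e) V by rewrite -(opath_all _ LV).
move: (eU) (eW); rewrite !all_cat => /and3P[eu es ev] /and3P[_ et _].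
step (@nil I) (@nil I) [:: (u, K, v ++ [:: e])] (@nil (layer n)) (IH _ eW LV).
(* The slide splits along [u], the vertex and [v]: the outer parts commute with the vertex by
   interchange, the middle one by [slide_back_nat1]. *)
rewrite !slide_back_cat; normalize.
step u (@nil I) (@nil (layer n))
  (wh u (slide_back (ktgt K) e) v ++ wh [::] (slide_back u e) (ktgt K ++ v) ++
      wh [:: e] L [::])
  (eqv_swap k [::] (opathk kK) (opath_slide_back ev)).
step u v (wh (u ++ ksrc K) (slide_back v e) [::])
  (wh [::] (slide_back u e) (ktgt K ++ v) ++ wh [:: e] L [::]) (slide_back_nat1 kK es).
close (@nil I) v
  (wh (u ++ ksrc K) (slide_back v e) [::] ++ wh u (slide_back (ksrc K) e) v)
  (wh [:: e] L [::]) (eqv_sym (eqv_swap k [::] (opath_slide_back eu) (opathk kK))).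
Qed.

(** Follows from [slide_back_nat], since [slide] and [slide_back] are mutually inverse. *)
Lemma slide_nat e U L V : all (distant e) U -> opath U L V ->
  eqv (e :: U) (V ++ [:: e]) (slide e U ++ wh [::] L [:: e]) (wh [:: e] L [::] ++
      slide e V).
Proof.
move=> eU UV; have eV : all (distant e) V by rewrite -(opath_all _ UV).
apply: eqv_trans (_ : eqv _ _ (slide e U ++ wh [::] L [:: e] ++ slide_back V e ++
    slide e V) _).
  apply: eqv_sym; close (@nil I) (@nil I) (slide e U ++ wh [::] L [:: e])
    (@nil (layer n)) (slide_back_slide eV).
step (@nil I) (@nil I) (slide e U) (slide e V) (slide_back_nat eU UV).
close (@nil I) (@nil I) (@nil (layer n)) (wh [:: e] L [::] ++ slide e V)
  (slide_slide_back eU).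
Qed.

Lemma slide_word_nat U D L V : all (fun e => all (distant e) U) D -> opath U L V ->
  eqv (U ++ D) (D ++ V) (wh [::] L D ++ slide_word V D) (slide_word U D ++ wh D L [::]).
Proof.
move=> /[swap] UV; elim: D => [|e D IH] /=.
  by move=> _; normalize; apply: eqv_refl; rewrite ?cats0.
case/andP=> eU UD.
have eV : all (distant e) V by rewrite -(opath_all _ UV).
have VD : all (fun c => all (distant c) V) D.
  by apply: sub_all UD => c; rewrite (opath_all _ UV).
step (@nil I) D (@nil (layer n)) (wh [:: e] (slide_word V D) [::]) (slide_back_nat eU UV).
close [:: e] (@nil I) (wh [::] (slide_back U e) D) (@nil (layer n)) (IH UD).
Qed.

(** [slide_word] recurses on its second word; this supplies the recursion on the first one. *)
Lemma slide_word_cons i U D : all (fun e => all (distant e) (i :: U)) D ->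
  eqv (i :: U ++ D) (D ++ i :: U) (slide_word (i :: U) D) (wh [:: i] (slide_word U D)
      [::] ++ wh [::] (slide i D) U).
Proof.
elim: D => [|e D IH] /=; first by move=> _; apply: eqv_refl => /=; rewrite cats0.
case/andP=> /andP[ei eU] iUD.
have UD : all (fun e => all (distant e) U) D.
  by apply: sub_all iUD => c /andP[].
have iD : all (distant i) D by apply: sub_all iUD => c /andP[/distant_sym].
normalize; step [:: e] (@nil I) (wh [:: i] (slide_back U e) D ++
    [:: ([::], KX i e, U ++ D)]) (@nil (layer n)) (IH iUD).
close (@nil I) (@nil I) (wh [:: i] (slide_back U e) D) (wh [:: e] (slide i D) U)
  (eqv_swap k [::] (opathk (distant_sym ei : kok (KX i e))) (opath_slide_word UD)).
Qed.

Lemma slide_word1 i D : slide_word [:: i] D = slide i D :> seq (layer n).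
Proof. by elim: D => [|e D IH] //=; rewrite IH; normalize. Qed.

Lemma hop_catr a b E1 E E3 :
  hop a b E1 (E ++ E3) = wh [::] (hop a b E1 E) E3 ++ wh (E1 ++ b :: a ::
      E) (slide b E3) [::].
Proof. by rewrite /hop slide_cat; normalize. Qed.

(** Two hops at distant places of a staircase commute, up to exchanging the letters [i], [j] at the
    start. *)
Lemma hop_hop i b F1 F2 j b' F3 :
  b = i.+1 :> nat -> b' = j.+1 :> nat -> distant i j -> distant b j -> distant b b' ->
  all (distant i) F1 -> all (distant j) F1 -> all (distant b) F2 -> all (distant j) F2 ->
  all (distant b) F3 -> all (distant b') F3 ->
  eqv (i :: j :: F1 ++ b :: i :: F2 ++ b' :: j :: F3)
      (F1 ++ b :: i :: F2 ++ b' :: j :: F3 ++ [:: b'; b])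
   (([::], KX i j, F1 ++ b :: i :: F2 ++ b' :: j :: F3) ::
      wh [:: j] (hop i b F1 (F2 ++ b' :: j :: F3)) [::] ++
      wh [::] (hop j b' (F1 ++ b :: i :: F2) F3) [:: b])
   (wh [:: i] (hop j b' (F1 ++ b :: i :: F2) F3) [::] ++
     hop i b F1 (F2 ++ b' :: j :: F3 ++ [:: b'])).
Proof.
move=> ei ej ij bj bb iF1 jF1 bF2 jF2 bF3 b'F3.
have [ji jb] : distant j i /\ distant j b by split; apply: distant_sym.
(* The letter [i] hops inside [W] and only slides along [Z]; the letter [j] slides along [W] and
   hops inside [Z]. [G] and [J] will be these two hops. *)
set W := F1 ++ b :: i :: F2; set Z := b' :: j :: F3.
have jW : all (distant j) W by rewrite /W; all_auto.
have bZ : all (distant b) Z by rewrite /Z; all_auto.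
set G := hop i b F1 F2.
have hG : opath (i :: W) G (W ++ [:: b]).
  by apply: opath_eq (opath_hop ei iF1 bF2) _ _; rewrite /W; normalize.
set J := ([::], KT j b', F3) :: wh [:: b'; j] (slide b' F3) [::].
set Y := Z ++ [:: b'].
have hJ : opath (j :: Z) J Y.
  rewrite /J /Y /Z; eapply opath_cons; last opath_chain.
  by apply: opathl; rewrite //= ej.
have bY : all (distant b) Y by rewrite /Y; all_auto.
have -> : hop i b F1 (F2 ++ Z) = wh [::] G Z ++ wh W (slide b Z) [::] by rewrite hop_catr.
have -> : hop i b F1 (F2 ++ b' :: j :: F3 ++ [:: b']) = wh [::] G Y ++
    wh W (slide b Y) [::].
  by rewrite -hop_catr /Y /Z; normalize.
have -> : hop j b' W F3 = wh [::] (slide j W) Z ++ wh W J [::].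
  by rewrite /hop /J; normalize.
have -> : F1 ++ b :: i :: F2 ++ Z = W ++ Z by rewrite /W; normalize.
have -> : F1 ++ b :: i :: F2 ++ b' :: j :: F3 ++ [:: b'; b] = W ++ Y ++ [:: b].
  by rewrite /W /Y /Z; normalize.
clearbody W Z Y G J; normalize.
step (@nil I) (@nil I) ((@nil I, KX i j, W ++ Z) :: wh [:: j] G Z) (wh W J [:: b])
  (eqv_sym (eqv_swap k [::] (opath_slide jW) (opath_slide bZ))).
(* Inserting [X X = 1] between [W] and [Z] completes two slides: that of [j] past the whole of [G],
   and that of [b] past the whole of [J]. *)
step W Z ((@nil I, KX i j, W ++ Z) :: wh [:: j] G Z ++ wh [::] (slide j W) (b :: Z))
  (wh (W ++ [:: j]) (slide b Z) [::] ++ wh W J [:: b]) (eqv_sym (eqv_XX k jb)).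
have jiW : all (distant j) (i :: W) by all_auto.
have N : eqv (j :: i :: W) (W ++ [:: b; j])
    (wh [:: j] G [::] ++ wh [::] (slide j W) [:: b] ++ [:: (W, KX j b, [::])])
    (([::], KX j i, W) :: wh [:: i] (slide j W) [::] ++ wh [::] G [:: j]).
  by apply: eqv_conv (eqv_sym (slide_nat jiW hG)) _ _ _ _; rewrite ?slide_cat; normalize.
step (@nil I) Z [:: (@nil I, KX i j, W ++ Z)]
  ((W, KX b j, Z) :: wh (W ++ [:: j]) (slide b Z) [::] ++ wh W J [:: b]) N.
step (@nil I) (W ++ Z) (@nil (layer n)) (wh [:: i] (slide j W) Z ++ wh [::] G (j :: Z) ++
  (W, KX b j, Z) :: wh (W ++ [:: j]) (slide b Z) [::] ++ wh W J [:: b]) (eqv_XX k ij).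
have bjZ : all (distant b) (j :: Z) by all_auto.
step W (@nil I) (wh [:: i] (slide j W) Z ++ wh [::] G (j ::
    Z)) (@nil (layer n)) (slide_nat bjZ hJ).
close (@nil I) (@nil I) (wh [:: i] (slide j W) Z) (wh W (slide b Y) [::])
  (eqv_swap k [::] hG hJ).
Qed.

End SlideRelations.

(** * The Zamolodchikov relation inside a staircase *)

Section Zam.
Variables (k : fieldType) (n : nat).
Local Notation I := 'I_n.
Local Notation eqv := (@eqv k n).
Implicit Types (x y z t u v U V D E M : seq I) (i j a b c e : I) (L : seq (layer n)) (K
    : kind n).

Lemma hop_catl a b F1 E1 E3 :
  hop a b (F1 ++ E1) E3 = wh [::] (slide a F1) (E1 ++ b :: a :: E3) ++
      wh F1 (hop a b E1 E3) [::].
Proof. by rewrite /hop slide_cat; normalize. Qed.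

(* Extends P : U M -> M V to U F1 M F3 -> F1 M F3 V, where U is distant from F1
   and V from F3. *)
Definition pass (F1 M F3 U : seq I) (P : seq (layer n)) (V : seq I) : seq (layer n) :=
  wh [::] (slide_word U F1) (M ++ F3) ++ wh F1 P F3 ++ wh (F1 ++
      M) (slide_word V F3) [::].

Lemma opath_pass F1 M F3 U P V : all (fun e => all (distant e) U) F1 ->
  all (fun e => all (distant e) V) F3 -> opath (U ++ M) P (M ++ V) ->
  opath (U ++ F1 ++ M ++ F3) (pass F1 M F3 U P V) (F1 ++ M ++ F3 ++ V).
Proof. by move=> hU hV hP; rewrite /pass; opath_chain. Qed.

Ltac opath_block ::=
  lazymatch goal with
  | |- is_true (opath _ (slide _ _) _) => apply: opath_slide; all_auto
  | |- is_true (opath _ (slide_back _ _) _) => apply: opath_slide_back; all_auto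
  | |- is_true (opath _ (slide_word _ _) _) => apply: opath_slide_word; all_auto
  | |- is_true (opath _ (hop _ _ _ _) _) => apply: opath_hop; all_auto
  | |- is_true (opath _ (pass _ _ _ _ _ _) _) => eapply opath_pass; [all_auto
      | all_auto | first [eassumption | opath_chain]]
  | |- _ => eassumption
  end.

(** By interchange, strands that pass one after another may first pass [F1] together, then [M], then
    [F3]. *)
Lemma pass_cons F1 M F3 i p e U P V :
  all (fun e => all (distant e) (i :: U)) F1 ->
  all (fun j => all (distant j) (e :: V)) F3 ->
  opath (i :: M) p (M ++ [:: e]) -> opath (U ++ M) P (M ++ V) ->
  eqv (i :: U ++ F1 ++ M ++ F3) (F1 ++ M ++ F3 ++ e :: V)
    (wh [:: i] (pass F1 M F3 U P V) [::] ++ wh [::] (pass F1 M F3 [:: i] p [:: e]) V)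
    (pass F1 M F3 (i :: U) (wh [:: i] P [::] ++ wh [::] p V) (e :: V)).
Proof.
move=> iU eV hp hP; rewrite /pass !slide_word1.
have hi : all (distant i) F1 by apply: sub_all iU => c /andP[/distant_sym].
have he : all (distant e) F3 by apply: sub_all eV => c /andP[/distant_sym].
have hU : all (fun e => all (distant e) U) F1 by apply: sub_all iU => c /andP[].
have hV : all (fun e => all (distant e) V) F3 by apply: sub_all eV => c /andP[].
have hA : opath (i :: F1 ++ M) (wh [::] (slide i F1) M ++ wh F1 p [::]) (F1 ++ M ++
    [:: e]).
  by opath_chain.
normalize; step (@nil I) (@nil I) (wh [:: i] (slide_word U F1) (M ++ F3) ++ wh (i ::
    F1) P F3)
  (wh (F1 ++ M) (slide e F3) V)
  (eqv_sym (eqv_swap k [::] hA (opath_slide_word hV))).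
step (@nil I) F3 (wh [:: i] (slide_word U F1) (M ++ F3))
  (wh F1 p (V ++ F3) ++ wh (F1 ++ M ++ [:: e]) (slide_word V F3) [::] ++ wh (F1 ++
      M) (slide e F3) V)
  (eqv_sym (eqv_swap k [::] (opath_slide hi) hP)).
step (@nil I) (M ++ F3) (@nil (layer n))
  (wh (F1 ++ [:: i]) P F3 ++ wh F1 p (V ++ F3) ++
    wh (F1 ++ M ++ [:: e]) (slide_word V F3) [::] ++ wh (F1 ++ M) (slide e F3) V)
  (eqv_sym (slide_word_cons k iU)).
close (F1 ++ M) (@nil I)
  (wh [::] (slide_word (i :: U) F1) (M ++ F3) ++ wh (F1 ++ [:: i]) P F3 ++
      wh F1 p (V ++ F3))
  (@nil (layer n)) (eqv_sym (slide_word_cons k eV)).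
Qed.

Section ABC.
Variables (a b c : I).
Hypotheses (eb : b = a.+1 :> nat) (ec : c = b.+1 :> nat).

Let ac : distant a c. Proof. by rewrite /distant; lia. Qed.
Let ca : distant c a. Proof. exact: distant_sym. Qed.

Local Notation pa := (hop a b [:: c] [::]).
Local Notation pb := (hop b c [::] [:: a]).

(** The Zamolodchikov relation for the staircase [c b a]. The extra last crossing in [eqv_zam] is
    undone by the last crossing on the left-hand side. *)
Lemma zam_core : eqv [:: a; b; a; c; b; a] [:: c; b; a; c; b; c]
  (([::], KT a b, [:: c; b; a]) :: wh [:: b; a] pb [::] ++ wh [:: b] pa [:: c] ++
      wh [::] pb [:: b; c])
  (wh [:: a; b] pa [::] ++ wh [:: a] pb [:: b] ++ wh [::] pa [:: c; b] ++ [:: ([:: c;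
      b; a], KT b c, [::])]).
Proof.
have bk : kok (KT b c) by rewrite /= ec.
have ak : kok (KT a b) by rewrite /= eb.
rewrite /hop /=; normalize.
step [:: b] (@nil I) [:: (@nil I, KT a b, [:: c; b; a]); ([:: b; a], KT b c, [:: a])]
  [:: ([:: b; c], KT a b, [:: c]); (@nil I, KT b c, [:: a; b; c]); ([:: c;
      b], KX c a, [:: b; c])]
  (eqv_sym (eqv_swap k [:: b] (opathk (ac : kok (KX a c))) (opathk (ca : kok (KX c a))))).
step (@nil I) (@nil I) (@nil (layer n)) [:: ([:: c; b], KX c a, [:: b;
    c])] (eqv_zam k eb ec).
step [:: c; b] [:: b; c] [:: ([:: a; b], KX a c, [:: b; a]); ([:: a; b; c], KT a b, [::]);
        ([:: a], KT b c, [:: a; b]); (@nil I, KX a c, [:: b; c; a; b]);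
        ([:: c; a; b], KX c a, [:: b]); ([:: c], KT a b, [:: c; b]);
        ([:: c; b; a], KT b c, [::])] (@nil (layer n)) (eqv_XX k ac).
close (@nil I) [:: b]
  [:: ([:: a; b], KX a c, [:: b; a]); ([:: a; b; c], KT a b, [::]);
      ([:: a], KT b c, [:: a; b])]
  [:: ([:: c], KT a b, [:: c; b]); ([:: c; b; a], KT b c, [::])]
  (eqv_swap k [:: b] (opathk (ac : kok (KX a c))) (opathk (ca : kok (KX c a)))).
Qed.

Section Full.
Variables F1 F3 : seq I.
Hypotheses (aF1 : all (distant a) F1) (bF1 : all (distant b) F1).
Hypotheses (bF3 : all (distant b) F3) (cF3 : all (distant c) F3).

Local Notation M := [:: c; b; a].


Let all_dist (s : seq I) F : all (fun i => all (distant i) F) s ->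
  all (fun e => all (distant e) s) F.
Proof.
move=> /allP h; apply/allP => e eF; apply/allP => i /h /allP /(_ e eF).
exact: distant_sym.
Qed.

Lemma hop_a : hop a b (F1 ++ [:: c]) F3 = pass F1 M F3 [:: a] pa [:: b].
Proof. by rewrite /pass !slide_word1 -[F3 in LHS]cat0s hop_catr hop_catl; normalize. Qed.

Lemma hop_b : hop b c F1 (a :: F3) = pass F1 M F3 [:: b] pb [:: c].
Proof. by rewrite /pass !slide_word1 -[F1 in LHS]cats0 -[a ::
    F3]cat1s hop_catr hop_catl; normalize. Qed.

Lemma opath_pa : opath (a :: M) pa (M ++ [:: b]).
Proof. by apply: opath_eq (opath_hop eb _ _) _ _; rewrite //= ac. Qed.

Lemma opath_pb : opath (b :: M) pb (M ++ [:: c]).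
Proof. by apply: opath_eq (opath_hop ec _ _) _ _; rewrite //= ca. Qed.

(* Pulling b a b, respectively a b a, through a staircase containing c b a. *)
Lemma zam_full : eqv (a :: b :: a :: F1 ++ c :: b :: a :: F3) (F1 ++ c :: b :: a ::
    F3 ++ [:: c; b; c])
  (([::], KT a b, F1 ++ c :: b :: a :: F3) :: wh [:: b; a] (hop b c F1 (a :: F3)) [::] ++
   wh [:: b] (hop a b (F1 ++ [:: c]) F3) [:: c] ++ wh [::] (hop b c F1 (a ::
       F3)) [:: b; c])
  (wh [:: a; b] (hop a b (F1 ++ [:: c]) F3) [::] ++ wh [:: a] (hop b c F1 (a ::
      F3)) [:: b] ++
   wh [::] (hop a b (F1 ++ [:: c]) F3) [:: c; b] ++
   [:: (F1 ++ c :: b :: a :: F3, KT b c, [::])]).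
Proof.
have Ha := opath_pa; have Hb := opath_pb.
have bk : kok (KT b c) by rewrite /= ec.
have ak : kok (KT a b) by rewrite /= eb.
have a1 : all (fun e => all (distant e) [:: a]) F1 by apply: all_dist => /=; rewrite aF1.
have b1 : all (fun e => all (distant e) [:: b]) F1 by apply: all_dist => /=; rewrite bF1.
have ab1 : all (fun e => all (distant e) [:: a; b]) F1.
  by apply: all_dist => /=; rewrite aF1 bF1.
have ba1 : all (fun e => all (distant e) [:: b; a]) F1.
  by apply: all_dist => /=; rewrite aF1 bF1.
have aba1 : all (fun e => all (distant e) [:: a; b; a]) F1.
  by apply: all_dist => /=; rewrite aF1 bF1.
have bab1 : all (fun e => all (distant e) [:: b; a; b]) F1.
  by apply: all_dist => /=; rewrite aF1 bF1.
have b3 : all (fun e => all (distant e) [:: b]) F3 by apply: all_dist => /=; rewrite bF3.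
have c3 : all (fun e => all (distant e) [:: c]) F3 by apply: all_dist => /=; rewrite cF3.
have cb3 : all (fun e => all (distant e) [:: c; b]) F3.
  by apply: all_dist => /=; rewrite cF3 bF3.
have bc3 : all (fun e => all (distant e) [:: b; c]) F3.
  by apply: all_dist => /=; rewrite cF3 bF3.
have bcb3 : all (fun e => all (distant e) [:: b; c; b]) F3.
  by apply: all_dist => /=; rewrite cF3 bF3.
have cbc3 : all (fun e => all (distant e) [:: c; b; c]) F3.
  by apply: all_dist => /=; rewrite cF3 bF3.
rewrite hop_a hop_b; have := zam_core.
move: (hop a b _ _) (hop b c _ _) Ha Hb => qa qb Ha Hb Z.
have Hab : opath ([:: a; b] ++ M) (wh [:: a] qb [::] ++ wh [::] qa [:: c]) (M ++ [:: b;
    c]).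
  by opath_chain.
have Hbab : opath ([:: b; a; b] ++ M)
    (wh [:: b] (wh [:: a] qb [::] ++ wh [::] qa [:: c]) [::] ++ wh [::] qb [:: b; c])
    (M ++ [:: c; b; c]) by opath_chain.
have Hba : opath ([:: b; a] ++ M) (wh [:: b] qa [::] ++ wh [::] qb [:: b]) (M ++ [:: c;
    b]).
  by opath_chain.
have Haba : opath ([:: a; b; a] ++ M)
    (wh [:: a] (wh [:: b] qa [::] ++ wh [::] qb [:: b]) [::] ++ wh [::] qa [:: c; b])
    (M ++ [:: b; c; b]) by opath_chain.
(* Each side is regrouped into one [pass] of three strands. *)
step [:: b] (@nil I) [:: (@nil I, KT a b, F1 ++ c :: b :: a :: F3)]
  (wh [::] (pass F1 M F3 [:: b] qb [:: c]) [:: b; c]) (pass_cons ab1 bc3 Ha Hb).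
step (@nil I) (@nil I) [:: (@nil I, KT a b, F1 ++ c :: b :: a :: F3)]
  (@nil (layer n)) (pass_cons bab1 cbc3 Hb Hab).
apply: eqv_sym.
step [:: a] (@nil I) (@nil (layer n))
  (wh [::] (pass F1 M F3 [:: a] qa [:: b]) [:: c; b] ++ [:: (F1 ++ c :: b :: a ::
      F3, KT b c, [::])])
  (pass_cons ba1 cb3 Hb Ha).
step (@nil I) (@nil I) (@nil (layer n))
  [:: (F1 ++ c :: b :: a :: F3, KT b c, @nil I)]
  (pass_cons aba1 bcb3 Ha Hba).
apply: eqv_sym; rewrite /pass; normalize.
(* The vertex [KT a b] slides past [F1], becomes [KT b c] across [M] by the core relation, and then
   slides past [F3]. *)
step (@nil I) (M ++ F3) (@nil (layer n))
  (wh F1 (wh [:: b; a] qb [::] ++ wh [:: b] qa [:: c] ++ wh [::] qb [:: b; c]) F3 ++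
   wh (F1 ++ M) (slide_word [:: c; b; c] F3) [::]) (slide_word_nat k aba1 (opathk ak)).
step F1 F3 (wh [::] (slide_word [:: a; b; a] F1) (M ++ F3))
  (wh (F1 ++ M) (slide_word [:: c; b; c] F3) [::]) Z.
close (F1 ++ M) (@nil I)
  (wh [::] (slide_word [:: a; b; a] F1) (M ++ F3) ++ wh F1 (wh [:: a; b] qa [::] ++
      wh [:: a] qb [:: b] ++ wh [::] qa [:: c; b]) F3)
  (@nil (layer n)) (slide_word_nat k bcb3 (opathk bk)).
Qed.
End Full.

(** The case where the staircase [F1 c b a] shrinks to [F1 c]. It is [zam_full] with empty [F3],
    followed by the inverse of the final crossing of [c] and [a]. *)
Lemma zam_ent F1 : all (distant a) F1 -> all (distant b) F1 ->
  eqv (a :: b :: a :: F1 ++ [:: c; b; a]) (F1 ++ [:: c; b; c; a; b; c])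
  (([::], KT a b, F1 ++ [:: c; b; a]) :: wh [:: b; a] (hop b c F1 [:: a]) [::] ++
   wh [:: b] (hop a b (F1 ++ [:: c]) [::]) [:: c] ++ wh [::] (hop b c F1 [::]) [:: a;
       b; c])
  (wh [:: a; b] (hop a b (F1 ++ [:: c]) [::]) [::] ++ wh [:: a] (hop b c F1 [::]) [::
      a; b] ++
   wh [::] (slide a (F1 ++ [:: c])) [:: b; c; a; b] ++
   wh (F1 ++ [:: c]) [:: ([:: a; b], KX c a, [:: b]); ([::], KT a b, [:: c; b]);
      ([:: b; a], KT b c, [::]); ([:: b], KX a c, [:: b; c])] [::]).
Proof.
move=> aF bF; have := zam_full (F3 := [::]) aF bF isT isT.
have -> : hop b c F1 [:: a] = wh [::] (hop b c F1 [::]) [:: a] ++ [:: (F1 ++ [:: c;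
    b], KX c a, [::])].
  by rewrite (hop_catr b c F1 [::] [:: a]) /=; normalize.
have aFc : all (distant a) (F1 ++ [:: c]) by rewrite all_cat aF /= ac.
have hb : opath (b :: F1 ++ [:: c; b]) (hop b c F1 [::]) (F1 ++ [:: c; b; c]).
  by apply: opath_hop; rewrite ?ec.
have ha : opath (a :: F1 ++ [:: c; b; a]) (hop a b (F1 ++ [:: c]) [::]) (F1 ++ [:: c;
    b; a; b]).
  by apply: opath_eq (opath_hop eb aFc _) _ _; normalize.
set hB := hop b c F1 [::]; set hA := hop a b (F1 ++ [:: c]) [::].
rewrite -/hB in hb; rewrite -/hA in ha.
have bk : kok (KT b c) by rewrite /= ec.
have ak : kok (KT a b) by rewrite /= eb.
normalize => Z.
step (F1 ++ [:: c; b]) [:: b; c] ((@nil I, KT a b, F1 ++ [:: c; b; a]) :: wh [:: b;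
    a] hB [:: a] ++
  (b :: a :: F1 ++ [:: c; b], KX c a, @nil I) :: wh [:: b] hA [:: c] ++
      wh [::] hB [:: a; b; c])
  (@nil (layer n)) (eqv_sym (eqv_XX k ca)).
step (@nil I) (@nil I) (@nil (layer n)) [:: (F1 ++ [:: c; b], KX a c, [:: b; c])] Z.
close (@nil I) [:: b]
  (wh [:: a; b] (slide a (F1 ++ [:: c])) [:: b; a] ++ ([:: a, b & F1 ++
      [:: c]], KT a b, [::]) :: wh [:: a] (slide b F1) [:: c; b; a; b] ++ [:: (a ::
          F1, KT b c, [:: a; b])])
  (wh (F1 ++ [:: c]) [:: (@nil I, KT a b, [:: c; b]); ([:: b; a], KT b c, [::]);
      ([:: b], KX a c, [:: b; c])] [::])
  (eqv_sym (eqv_swap k [:: b] (opath_slide aFc) (opathk (ca : kok (KX c a))))).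
Qed.

End ABC.
End Zam.

(** * Staircases and the canonical path *)

Section Staircases.
Variable n : nat.
Local Notation I := 'I_n.
Implicit Types (x y z u v D E F G : seq I) (i j a b c e t : I) (L S C : seq (layer n)).

Definition desc E := sorted (fun i j : I => i == j.+1 :> nat) E.

Lemma desc_pairwise E : desc E -> pairwise (fun i j : I => j < i) E.
Proof.
rewrite -sorted_pairwise; last by move=> i j l /= ji il; apply: ltn_trans il ji.
by apply: sub_sorted => i j /eqP->.
Qed.

Lemma desc_catl E F : desc (E ++ F) -> desc E.
Proof. by case: E => //= e E; rewrite /desc /= cat_path => /andP[]. Qed.

Lemma desc_catr E F : desc (E ++ F) -> desc F.
Proof.
case: E => //= e E; rewrite /desc /= cat_path => /andP[_].
by case: F => //= f F /andP[].
Qed.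

Lemma desc_mid E e F : desc (E ++ e :: F) ->
  (forall i, i \in E -> e < i) /\ (forall i, i \in F -> i < e).
Proof.
move/desc_pairwise; rewrite pairwise_cat /= => /and3P[/allrelP h _ /andP[/allP h' _]].
by split=> // i iE; apply: h => //; rewrite mem_head.
Qed.

Lemma desc_step E e f F : desc (E ++ e :: f :: F) -> e = f.+1 :> nat.
Proof. by move/desc_catr => /= /andP[/eqP]. Qed.

(** Letters strictly decrease, so a smaller one stands further right. *)
Lemma desc_split E e F E' f F' : desc (E ++ e :: F) -> E ++ e :: F = E' ++ f :: F' ->
  f < e -> exists G, E' = E ++ e :: G /\ F = G ++ f :: F'.
Proof.
elim: E E' => [|i E IH] [|i' E'] dE /= [].
- by move=> ->; rewrite ltnn.
- by move=> <- eF; exists E'.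
- move=> ei _; have [_ /(_ e)] := desc_mid (E := [::]) dE.
  by rewrite mem_cat mem_head orbT ei => /(_ isT) ef fe; lia.
move=> <- eqE fe; have [|G [-> ->]] := IH E' _ eqE fe; last by exists G.
exact: (@desc_catr [:: i]).
Qed.

Lemma desc_uniq E e F E' F' : desc (E ++ e :: F) -> E ++ e :: F = E' ++ e :: F' ->
  E = E' /\ F = F'.
Proof.
elim: E E' => [|i E IH] [|i' E'] dE /= [] //.
- move=> <- eF; have [_ /(_ e)] := desc_mid (E := [::]) dE.
  by rewrite eF mem_cat mem_head orbT ltnn => /(_ isT).
- move=> ei _; have [_ /(_ e)] := desc_mid (E := [::]) dE.
  by rewrite mem_cat mem_head orbT ei ltnn => /(_ isT).
move=> <- /IH [|-> ->] //; exact: (@desc_catr [:: i]).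
Qed.

(** Letters before [b] exceed [a + 1] and letters after [a] are below [b - 1]; so a hop over [b a]
    is always possible in a staircase. *)
Lemma desc_hop E b a F : desc (E ++ b :: a :: F) ->
  [/\ b = a.+1 :> nat, all (distant a) E & all (distant b) F].
Proof.
move=> dE; have ba := desc_step dE; split=> //; apply/allP => e eE; rewrite /distant.
  by have [/(_ e eE)] := desc_mid dE; lia.
have := desc_mid (E := E ++ [:: b]) (e := a) (F := F); rewrite -catA => /(_ dE)[_ /(_ e
    eE)].
lia.
Qed.

(* [absorb t E E' x S]: the path S : t E -> E' x absorbs a letter t in front of
   the staircase E.  Seen from the left, the wire crossed by t leaves the space
   between the two wires of the staircase (Exit), or misses this space (Far), or
   t crosses two wires inside it (In), or the wire enters the space (Enter). *)
Variant absorb t E E' x S : Prop :=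
| AbsorbExit e F of E = e :: F & t = e.+1 :> nat & E' = t :: E & x = [::] & S = [::]
| AbsorbFar of all (distant t) E & E' = E & x = [:: t] & S = slide t E
| AbsorbIn b e F1 F3 of E = F1 ++ b :: t :: e :: F3 & b = t.+1 :> nat
    & E' = E & x = [:: b] & S = hop t b F1 (e :: F3)
| AbsorbEnter b F1 of E = F1 ++ [:: b; t] & b = t.+1 :> nat
    & E' = F1 ++ [:: b] & x = [:: t; b] & S = hop t b F1 [::].

Lemma absorb_desc t E E' x S : absorb t E E' x S -> desc E -> desc E'.
Proof.
case=> [e F -> et -> _ _ | _ -> | b e F1 F3 -> _ -> | b F1 -> _ -> _ _] //=.
  by move=> dE; apply/andP; split=> //; apply/eqP.
by rewrite -[[:: b; t]]cat1s catA => /desc_catl.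
Qed.

Lemma absorb_opath t E E' x S : desc E -> absorb t E E' x S -> opath (t :: E) S (E' ++ x).
Proof.
move=> dE; case=> [e F eE et -> -> -> | h -> -> -> | b e F1 F3 eE bt -> -> ->
    | b F1 eE bt -> -> ->].
- by rewrite /= cats0.
- exact: opath_slide.
- rewrite eE in dE *; have [_ h1 h3] := desc_hop dE.
  by apply: opath_eq (opath_hop bt h1 h3) _ _; normalize.
rewrite eE in dE *; have [_ h1 h3] := desc_hop dE.
by apply: opath_eq (opath_hop bt h1 h3) _ _; normalize.
Qed.

(** Exit needs the head [t - 1], Far fails at [t] itself, and In and Enter need [t + 1], which
    exceeds the largest letter. *)
Lemma absorb_head t F E' x S : desc (t :: F) -> ~ absorb t (t :: F) E' x S.
Proof.
move=> dE; case=> [e G [-> _] | | b e F1 F3 eE bt | b F1 eE bt]; try lia.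
- by rewrite /= /distant => /andP[]; lia.
- have [_ /(_ b)] := desc_mid (E := [::]) dE.
  have : b \in t :: F by rewrite eE mem_cat mem_head orbT.
  by rewrite inE => /orP[/eqP/(congr1 val)/= | h /(_ h)]; lia.
have [_ /(_ b)] := desc_mid (E := [::]) dE.
have : b \in t :: F by rewrite eE mem_cat mem_head orbT.
by rewrite inE => /orP[/eqP/(congr1 val)/= | h /(_ h)]; lia.
Qed.

(* C : x -> E y is the canonical path; the first case is that of the crossing
   which is being pulled. *)
Fixpoint pull x E y C : Prop :=
  if x is t :: x' then
    [/\ E = [:: t], y = x' & C = [::]] \/
    exists E0 z y0 S C0, [/\ pull x' E0 y0 C0, absorb t E0 E z S, y = z ++ y0
      & C = wh [:: t] C0 [::] ++ wh [::] S y0]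
  else False.

Lemma pull_desc x E y C : pull x E y C -> desc E.
Proof.
elim: x E y C => //= t x IH E y C [[-> _ _] // | [E0 [z [y0 [S [C0 [/IH dE h _ _]]]]]]].
exact: absorb_desc h dE.
Qed.

Lemma pull_opath x E y C : pull x E y C -> opath x C (E ++ y).
Proof.
elim: x E y C => //= t x IH E y C [[-> -> ->] /= | ]; first by rewrite eqxx.
case=> E0 [z [y0 [S [C0 [h0 h -> ->]]]]].
have := absorb_opath (pull_desc h0) h => hS; have hC := IH _ _ _ h0.
by opath_auto.
Qed.

Lemma desc_head t F b : desc (t :: F) -> b \in t :: F -> b <= t.
Proof.
move=> dE; have [_ h] := desc_mid (E := [::]) dE.
by rewrite inE => /orP[/eqP-> // | /h /ltnW].
Qed.

Lemma distant_irr t : distant t t = false.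
Proof. by rewrite /distant; lia. Qed.

(** The resulting staircase reveals the case: it starts with [t] (Exit), is distant from [t] (Far),
    has [t] right after [t + 1] (In), or ends with [t + 1] (Enter). *)
Lemma absorb_inj t E E1 E2 x1 x2 S1 S2 :
  desc E1 -> desc E2 -> absorb t E1 E x1 S1 -> absorb t E2 E x2 S2 ->
  [/\ E1 = E2, x1 = x2 & S1 = S2].
Proof.
move=> d1 d2 h1 h2; have dE := absorb_desc h1 d1.
have mid (F1 : seq I) b F3 : b \in F1 ++ b :: F3 by rewrite mem_cat mem_head orbT.
case: h1 => [e F eE et eE' -> -> | al eE' -> -> | b e F1 F3 eE bt eE' -> ->
    | b F1 eE bt eE' -> ->];
case: h2 => [e' F' eE2 et' eE2' -> -> | al' eE2' -> -> | b' e' F1' F3' eE2 bt' eE2' ->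
    -> | b' F1' eE2 bt' eE2' -> ->].
- by move: eE2'; rewrite eE' => -[->].
- by move: al'; rewrite -eE2' eE' /= distant_irr.
- have := mid F1' b' (t :: e' :: F3'); rewrite -eE2 -eE2' eE' => h.
  by have := desc_head (eq_ind E (fun G => is_true (desc G)) dE _ eE') h; lia.
- have := mid F1' b' [::]; rewrite -eE2' eE' => h.
  by have := desc_head (eq_ind E (fun G => is_true (desc G)) dE _ eE') h; lia.
- by move: al; rewrite -eE' eE2' /= distant_irr.
- by rewrite -eE' -eE2'.
- by move: al; rewrite -eE' eE2' eE2 all_cat /= distant_irr /= !andbF.
- by move: al; rewrite -eE' eE2' all_cat /= /distant; lia.
- have := mid F1 b (t :: e :: F3); rewrite -eE -eE' eE2' => h.
  by have := desc_head (eq_ind E (fun G => is_true (desc G)) dE _ eE2') h; lia.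
- by move: al'; rewrite -eE2' eE' eE all_cat /= distant_irr /= !andbF.
- move: (eE) (eE2); rewrite -eE' -eE2' => eF eF'; subst E1; rewrite -cat1s catA in eF.
  have [] := @desc_uniq (F1 ++ [:: b]) t (e :: F3) (F1' ++ [:: b']) (e' :: F3');
      rewrite -?catA //=.
    by rewrite -eF' eF -catA.
  by rewrite !cats1 => /rcons_inj[-> ->] [-> ->].
- have eb : b' = b by apply: val_inj => /=; lia.
  move: eE2'; rewrite eE' eE eb => h; move: dE; rewrite eE' eE => dE.
  by have [] := desc_uniq dE h.
- have := mid F1 b [::]; rewrite -eE' eE2' => h.
  by have := desc_head (eq_ind E (fun G => is_true (desc G)) dE _ eE2') h; lia.
- by move: al'; rewrite -eE2' eE' all_cat /= /distant; lia.
- have eb : b' = b by apply: val_inj => /=; lia.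
  move: eE'; rewrite eE2' eE2 eb => h; move: dE; rewrite eE2' eE2 eb => dE.
  by have [] := desc_uniq dE h.
by move: eE2'; rewrite eE eE2 eE' !cats1 => /rcons_inj[-> ->].
Qed.

(** Reading [x] from the left, [absorb_inj] undoes the absorptions one by one until the pulled
    crossing is reached. *)
Lemma pull_inj x E y1 y2 C1 C2 : pull x E y1 C1 -> pull x E y2 C2 -> y1 = y2 /\ C1 = C2.
Proof.
elim: x E y1 y2 C1 C2 => //= t x IH E y1 y2 C1 C2.
(* The two cases of [pull] exclude each other: absorbing [t] never yields the one-letter staircase
   [t]. *)
have excl E0 z S : desc E0 -> absorb t E0 [:: t] z S -> False.
  move=> dE [e F -> _ [] | h eE | b e F1 F3 -> _ | b F1 _ bt] //.
  - by move: h; rewrite -eE /= distant_irr.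
  - by case: F1 => [|? [|? ?]].
  by case: F1 => [|? [|? ?]] // [] /(congr1 val) /=; lia.
case=> [[-> -> ->] | [E1 [z1 [x1 [S1 [D1 [c1 h1 -> ->]]]]]]];
case=> [[eE -> ->] | [E2 [z2 [x2 [S2 [D2 [c2 h2 -> ->]]]]]]] //.
- by have := excl _ _ _ (pull_desc c2) h2.
- by subst E; have := excl _ _ _ (pull_desc c1) h1.
have [eE -> ->] := absorb_inj (pull_desc c1) (pull_desc c2) h1 h2; subst E2.
by have [-> ->] := IH _ _ _ _ _ c1 c2.
Qed.

End Staircases.

(** * Naturality at distant and adjacent edges *)

Section Squares.
Variables (k : fieldType) (n : nat).
Local Notation I := 'I_n.
Local Notation eqv := (@eqv k n).
Implicit Types (x y z u v D E F G : seq I) (i j a b c e t : I) (L S C : seq (layer n)).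

(* Absorbing i and then j in front of E0 (S1, S2) after the vertex X_ij, against
   absorbing j and then i (T1, T2); H relates the words left behind. *)
Definition far_square i j E0 E S1 x1 S2 x2 T1 y1 T2 H :=
  eqv (i :: j :: E0) (E ++ x2 ++ x1)
    (([::], KX i j, E0) :: wh [:: j] S1 [::] ++ wh [::] S2 x1)
    (wh [:: i] T1 [::] ++ wh [::] T2 y1 ++ wh E H [::]).

Lemma far_square_slide i j E0 E S2 x2 :
  distant i j -> all (distant i) E0 -> opath (j :: E0) S2 (E ++ x2) ->
  far_square i j E0 E (slide i E0) [:: i] S2 x2 S2 x2 (slide i E) (slide i x2).
Proof.
move=> ij iE0 hS; rewrite /far_square.
have ijE0 : all (distant i) (j :: E0) by all_auto.
by apply: eqv_conv (slide_nat k ijE0 hS) _ _ _ _; rewrite ?slide_cat /=; normalize.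
Qed.

(** Naturality of the slide of [j], framed by two pairs of mutually inverse paths: the crossings of
    [i] and [j], and the slides of [j] along [x1]. *)
Lemma far_square_slide_back i j E0 E1 S1 x1 :
  distant i j -> all (distant j) E0 -> opath (i :: E0) S1 (E1 ++ x1) ->
  far_square i j E0 E1 S1 x1 (slide j E1) [:: j] (slide j E0) [:: j] S1 (slide_back x1 j).
Proof.
move=> ij jE0 hS; rewrite /far_square.
have jiE0 : all (distant j) (i :: E0) by rewrite /= (distant_sym ij).
have := jiE0; rewrite (opath_all _ hS) all_cat => /andP[jE1 jx1].
have N : eqv (j :: i :: E0) (E1 ++ x1 ++ [:: j])
    (wh [:: j] S1 [::] ++ wh [::] (slide j E1) x1 ++ wh E1 (slide j x1) [::])
    (([::], KX j i, E0) :: wh [:: i] (slide j E0) [::] ++ wh [::] S1 [:: j]).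
  by apply: eqv_conv (eqv_sym (slide_nat k jiE0 hS)) _ _ _ _; rewrite ?slide_cat /=;
      normalize.
step E1 (@nil I) ((@nil I, KX i j, E0) :: wh [:: j] S1 [::] ++ wh [::] (slide j E1) x1)
  (@nil (layer n)) (eqv_sym (slide_slide_back k jx1)).
step (@nil I) (@nil I) [:: (@nil I, KX i j, E0)] (wh E1 (slide_back x1 j) [::]) N.
close (@nil I) E0 (@nil (layer n))
  (wh [:: i] (slide j E0) [::] ++ wh [::] S1 [:: j] ++ wh E1 (slide_back x1 j) [::])
  (eqv_XX k ij).
Qed.

(** The hop of [i] is to the left of that of [j]. The splitting [G ++ x2] is left free in order to
    cover both In and Enter for [j]. *)
Lemma far_square_hop i b F1 F2 j b' F3 G x2 :
  desc (F1 ++ b :: i :: F2 ++ b' :: j :: F3) -> distant i j ->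
  G ++ x2 = F2 ++ b' :: j :: F3 ++ [:: b'] ->
  far_square i j (F1 ++ b :: i :: F2 ++ b' :: j :: F3) (F1 ++ b :: i :: G)
    (hop i b F1 (F2 ++ b' :: j :: F3)) [:: b] (hop j b' (F1 ++ b :: i :: F2) F3) x2
    (hop j b' (F1 ++ b :: i :: F2) F3) x2 (hop i b F1 G) (slide b x2).
Proof.
move=> dE ij eG; rewrite /far_square.
have [eb iF1] := desc_hop dE; rewrite all_cat /= => /and4P[bF2 bb' bj bF3].
have dE' : desc ((F1 ++ b :: i :: F2) ++ b' :: j :: F3) by rewrite -catA.
have [eb' + b'F3] := desc_hop dE'.
rewrite !all_cat /= => /and4P[jF1 jb ji jF2].
apply: eqv_conv (hop_hop k eb eb' ij bj bb' iF1 jF1 bF2 jF2 bF3 b'F3) _ _ _ _;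
    normalize => //.
  by have := congr1 (fun s => F1 ++ b :: i :: s ++ [:: b]) eG; normalize.
by rewrite -eG hop_catr; normalize.
Qed.

Lemma far_square_hopr i b F2 j b' F3 G1 G x1 :
  desc (G1 ++ b' :: j :: F2 ++ b :: i :: F3) -> distant i j ->
  G ++ x1 = F2 ++ b :: i :: F3 ++ [:: b] ->
  far_square i j (G1 ++ b' :: j :: F2 ++ b :: i :: F3) (G1 ++ b' :: j :: G)
    (hop i b (G1 ++ b' :: j :: F2) F3) x1 (hop j b' G1 G) [:: b']
    (hop j b' G1 (F2 ++ b :: i :: F3)) [:: b'] (hop i b (G1 ++ b' :: j ::
        F2) F3) (slide_back x1 b').
Proof.
move=> dE ij eG; rewrite /far_square.
have [eb' jG1] := desc_hop dE; rewrite all_cat /= => /and4P[b'F2 b'b b'i b'F3].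
have dE' : desc ((G1 ++ b' :: j :: F2) ++ b :: i :: F3) by rewrite -catA.
have [eb + bF3] := desc_hop dE'.
rewrite !all_cat /= => /and4P[iG1 ib' _ iF2].
have ji := distant_sym ij.
have b'x1 : all (distant b') x1.
  suff : all (distant b') (G ++ x1) by rewrite all_cat => /andP[].
  by rewrite eG; all_auto.
have := hop_hop k eb' eb ji b'i b'b jG1 iG1 b'F2 iF2 b'F3 bF3.
have -> : hop j b' G1 (F2 ++ b :: i :: F3 ++ [:: b]) =
    wh [::] (hop j b' G1 G) x1 ++ wh (G1 ++ b' :: j :: G) (slide b' x1) [::].
  by rewrite -eG hop_catr.
have -> : G1 ++ b' :: j :: F2 ++ b :: i :: F3 ++ [:: b; b'] = G1 ++ b' :: j :: G ++
    x1 ++ [:: b'].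
  by have := congr1 (fun s => G1 ++ b' :: j :: s ++ [:: b']) eG; normalize.
have b'G : all (distant b') G.
  suff : all (distant b') (G ++ x1) by rewrite all_cat => /andP[].
  by rewrite eG; all_auto.
set E0 := G1 ++ b' :: j :: F2 ++ b :: i :: F3.
set E := G1 ++ b' :: j :: G.
have eE : E ++ x1 = E0 ++ [:: b].
  by have := congr1 (fun s => G1 ++ b' :: j :: s) eG; rewrite /E /E0; normalize.
have : opath (i :: E0) (hop i b (G1 ++ b' :: j :: F2) F3) (E ++ x1).
  rewrite eE; apply: opath_eq (opath_hop eb _ bF3) _ _; rewrite /E0 ?all_cat;
      try by_normalize.
  by rewrite iG1 /= ib' (distant_sym ji) iF2.
have : opath (j :: E0) (hop j b' G1 (F2 ++ b :: i :: F3)) (E0 ++ [:: b']).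
  by apply: opath_eq (opath_hop eb' jG1 _) _ _; rewrite /E0; try by_normalize; all_auto.
have : opath (j :: E) (hop j b' G1 G) (E ++ [:: b']).
  by apply: opath_eq (opath_hop eb' jG1 b'G) _ _; rewrite /E; normalize.
have -> : G1 ++ b' :: j :: G ++ x1 ++ [:: b'] = E ++ x1 ++ [:: b'] by rewrite /E;
    normalize.
move: (hop i b _ F3) (hop j b' G1 G) (hop j b' G1 (F2 ++ _)) E => hi hj hj' E in eE *.
clearbody E0; normalize => oj oj' oi N.
step E (@nil I) ((@nil I, KX i j, E0) :: wh [:: j] hi [::] ++ wh [::] hj x1)
  (@nil (layer n)) (eqv_sym (slide_slide_back k b'x1)).
step (@nil I) (@nil I) [:: (@nil I, KX i j, E0)] (wh E (slide_back x1 b') [::])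
    (eqv_sym N).
close (@nil I) E0 (@nil (layer n))
  (wh [:: i] hj' [::] ++ wh [::] hi [:: b'] ++ wh E (slide_back x1 b') [::])
  (eqv_XX k ij).
Qed.

(** After [i] has joined the staircase, the hop of [j] begins by crossing [i] back, which cancels
    the edge. *)
Lemma far_square_exit i j b F1 F3 E x2 : distant i j -> desc (F1 ++ b :: j :: F3) ->
  E ++ x2 = F1 ++ b :: j :: F3 ++ [:: b] ->
  far_square i j (F1 ++ b :: j :: F3) (i :: E) [::] [::] (hop j b (i :: F1) F3) x2
    (hop j b F1 F3) x2 [::] [::].
Proof.
move=> ij /desc_hop[eb jF1 bF3] eE; rewrite /far_square.
have hj := opath_hop eb jF1 bF3.
have -> : hop j b (i :: F1) F3 =
    ([::], KX j i, F1 ++ b :: j :: F3) :: wh [:: i] (hop j b F1 F3) [::].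
  by rewrite /hop /=; normalize.
have -> : (i :: E) ++ x2 ++ [::] = i :: F1 ++ b :: j :: F3 ++ [:: b].
  by rewrite -eE cats0.
move: (hop j b F1 F3) hj => hj oj; normalize.
close (@nil I) (F1 ++ b :: j :: F3) (@nil (layer n)) (wh [:: i] hj [::]) (eqv_XX k ij).
Qed.

Lemma far_square_exitr i j b F1 F3 E x1 : distant i j -> desc (F1 ++ b :: i :: F3) ->
  E ++ x1 = F1 ++ b :: i :: F3 ++ [:: b] ->
  far_square i j (F1 ++ b :: i :: F3) (j :: E) (hop i b F1 F3) x1 [::] [::]
    [::] [::] (hop i b (j :: F1) F3) [::].
Proof.
move=> ij /desc_hop[eb iF1 bF3] eE; rewrite /far_square.
have hi : opath (i :: (j :: F1) ++ b :: i :: F3) (hop i b (j :: F1) F3)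
    ((j :: F1) ++ b :: i :: F3 ++ [:: b]) by apply: opath_hop; rewrite //= ij.
have -> : (j :: E) ++ [::] ++ x1 = (j :: F1) ++ b :: i :: F3 ++ [:: b].
  by rewrite /= eE.
apply: eqv_conv (eqv_refl k hi) _ _ _ _; normalize => //.
by rewrite /hop /=; normalize.
Qed.

(** The pairs [b i] and [b' j] do not overlap, because [b' = j + 1] is smaller than [i]. *)
Lemma desc_split2 F1 b i F3 G1 b' j G3 : desc (F1 ++ b :: i :: F3) ->
  F1 ++ b :: i :: F3 = G1 ++ b' :: j :: G3 -> j.+1 < i ->
  exists2 F2, G1 = F1 ++ b :: i :: F2 & F3 = F2 ++ b' :: j :: G3.
Proof.
move=> dE eE ji; have := dE; rewrite eE => /desc_hop[eb' _ _].
have [|||G [e1 e2]] := @desc_split _ (F1 ++ [:: b]) i F3 (G1 ++ [:: b']) j G3.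
- by rewrite -catA.
- by rewrite -!catA.
- lia.
case/lastP: G e1 e2 => [|G c] e1 e2.
  have /rcons_inj[_ eb] : rcons G1 b' = rcons (F1 ++ [:: b]) i by rewrite -!cats1 e1.
  by move: eb' ji; rewrite eb; lia.
have /rcons_inj[-> eb] : rcons G1 b' = rcons (F1 ++ b :: i :: G) c.
  by rewrite -!cats1 e1 -cats1 -!catA.
by exists G => //; rewrite e2 eb -cats1 -catA.
Qed.

Lemma absorb_swap i j E0 E1 E x1 x2 S1 S2 :
  distant i j -> desc E0 -> absorb i E0 E1 x1 S1 -> absorb j E1 E x2 S2 ->
  exists E1' y1 y2 T1 T2 H, [/\ absorb j E0 E1' y1 T1, absorb i E1' E y2 T2,
    opath (y2 ++ y1) H (x2 ++ x1) & far_square i j E0 E S1 x1 S2 x2 T1 y1 T2 H].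
Proof.
move=> ij dE0 h1 h2; have ji := distant_sym ij.
have dE1 := absorb_desc h1 dE0; have dE := absorb_desc h2 dE1.
have o1 := absorb_opath dE0 h1; have o2 := absorb_opath dE1 h2.
have far1 : all (distant i) E0 -> E1 = E0 -> x1 = [:: i] -> S1 = slide i E0 ->
  exists E1' y1 y2 T1 T2 H, [/\ absorb j E0 E1' y1 T1, absorb i E1' E y2 T2,
    opath (y2 ++ y1) H (x2 ++ x1) & far_square i j E0 E S1 x1 S2 x2 T1 y1 T2 H].
  move=> iE0 eE1 ex1 eS1; subst E1 x1 S1.
  have : all (distant i) (j :: E0) by all_auto.
  rewrite (opath_all _ o2) all_cat => /andP[iE ix2].
  exists E, x2, [:: i], S2, (slide i E), (slide i x2); split=> //; first exact: AbsorbFar.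
    exact: opath_slide.
  exact: far_square_slide.
have dbb b b' : b = i.+1 :> nat -> b' = j.+1 :> nat -> distant b b'.
  by move: ij; rewrite /distant; lia.
have far2 : all (distant j) E1 -> E = E1 -> x2 = [:: j] -> S2 = slide j E1 ->
  exists E1' y1 y2 T1 T2 H, [/\ absorb j E0 E1' y1 T1, absorb i E1' E y2 T2,
    opath (y2 ++ y1) H (x2 ++ x1) & far_square i j E0 E S1 x1 S2 x2 T1 y1 T2 H].
  move=> jE1 eE ex2 eS2; subst E x2 S2.
  have jx1 : all (distant j) x1.
    move: jE1; case: (h1) => [e F _ _ _ -> _|_ _ -> _|b e F1 F3 -> _ ->
        -> _|b F1 _ _ -> -> _] //=.
    - by rewrite ji.
    - by rewrite all_cat /= => /and3P[_ ->].
    by rewrite all_cat /= ji => /and3P[_ ->].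
  have : all (distant j) (i :: E0) by rewrite (opath_all _ o1) all_cat jE1.
  case/andP=> _ jE0.
  exists E0, [:: j], x1, (slide j E0), S1, (slide_back x1 j); split=> //;
      first exact: AbsorbFar.
    exact: opath_slide_back.
  exact: far_square_slide_back.
(* Once the Far cases are settled, nine combinations remain, listed by the case of [j] and then of
   [i]. Two exits, or two entries, would make [i] and [j] adjacent. *)
case: (h2) => [e2 G0 eE1 je eE ex2 eS2 | jE1 eE ex2 eS2 | b' e2 G1 G3 eE1 jb' eE ex2 eS2
    | b' G1 eE1 jb' eE ex2 eS2]; [ | exact: far2 | | ];
        try have {}dbb b (bi : b = i.+1 :> nat) := dbb b b' bi jb';
  (case: (h1) => [e1 F0 eE0 ie eE1' ex1 eS1 | iE0 eE1' ex1 eS1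
    | b e1 F1 F3 eE0 bi eE1' ex1 eS1 | b F1 eE0 bi eE1' ex1 eS1];
    [ | exact: far1 | | ]); subst x1 S1 x2 S2; clear h1 h2 o1 o2 far1 far2.
- by move: eE1' ij; rewrite eE1 /distant => -[<- _]; lia.
- rewrite eE1' in eE eE1; subst E E1.
  exists (j :: E0), [::], [:: b], [::], (hop i b (j :: F1) (e1 :: F3)), [::].
  split; try by rewrite /= eqxx.
  + exact: AbsorbExit eE1 je _ _ _.
  + by apply: (AbsorbIn (F1 := j :: F1) _ bi) => //; rewrite eE0.
  rewrite eE0 in dE0 *; apply: far_square_exitr => //; by_normalize.
- rewrite eE1' in eE1 eE dE dE1; subst E E1.
  exists (j :: E0), [::], [:: i; b], [::], (hop i b (j :: F1) [::]), [::].
  split; try by rewrite /= eqxx.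
  + case: F1 eE1 eE0 {dE dE1} => [|f F1] /= [ef eF] eE0;
      subst e2; exact: AbsorbExit eE0 je _ _ _.
  + by apply: (AbsorbEnter (F1 := j :: F1) _ bi) => //; rewrite eE0.
  rewrite eE0 in dE0 *; apply: far_square_exitr => //; by_normalize.
- rewrite eE1' in eE1 eE dE dE1; subst E E1; case: G1 eE1 => [|f G1] [ef eE0'].
    by move: ij; rewrite ef /distant; lia.
  subst f; exists E0, [:: b'], [::], (hop j b' G1 (e2 :: G3)), [::], [::].
  split; try by rewrite /= eqxx.
  + exact: AbsorbIn eE0' jb' _ _ _.
  + exact: AbsorbExit eE0 ie _ _ _.
  rewrite eE0' in dE0 *; apply: far_square_exit => //; by_normalize.
- rewrite eE1' in eE1 eE dE dE1; subst E E1.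
  have : F1 ++ b :: i :: e1 :: F3 = G1 ++ b' :: j :: e2 :: G3 by rewrite -eE0.
  case: (ltngtP j i) => [ltji|ltij|/val_inj eij] eE; last by move: ij;
      rewrite eij distant_irr.
    have {}ltji : j.+1 < i by move: ij; rewrite /distant; lia.
    have [|F2 eG eF] := desc_split2 _ eE ltji; first by rewrite -eE0.
    exists E0, [:: b'], [:: b], (hop j b' G1 (e2 :: G3)), (hop i b F1 (e1 ::
        F3)), (slide b [:: b']).
    split=> //; [exact: AbsorbIn eE1 jb' _ _ _ | exact: AbsorbIn eE0 bi _ _ _ | | ].
      by apply: opath_slide; rewrite /= andbT; exact: dbb.
    rewrite eE0 in dE0 *; rewrite eF eG in dE0 *.
    by apply: far_square_hop => //; normalize.
  have {}ltij : i.+1 < j by move: ij; rewrite /distant; lia.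
  have [|F2 eF eG] := desc_split2 _ (esym eE) ltij; first by rewrite -eE1.
  exists E0, [:: b'], [:: b], (hop j b' G1 (e2 :: G3)), (hop i b F1 (e1 ::
      F3)), (slide_back [:: b] b').
  split=> //; [exact: AbsorbIn eE1 jb' _ _ _ | exact: AbsorbIn eE0 bi _ _ _ | | ].
    by apply: (opath_slide_back (U := [:: b])); rewrite /= andbT; exact/distant_sym/dbb.
  rewrite eE1 in dE0 *; rewrite eF eG in dE0 *.
  by apply: far_square_hopr => //; normalize.
- rewrite eE1' in eE1 eE dE dE1; subst E E1.
  have ltij : i.+1 < j.
    have := dE0; rewrite eE0 -[[:: b; i]]/([:: b] ++ [:: i]) catA => /desc_mid[/(_ j)].
    by rewrite eE1 mem_cat !inE eqxx !orbT => /(_ isT) + _; move: ij; rewrite /distant;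
        lia.
  (* Restoring the letter [i] lost in the entry locates the pair [b' j] inside [E0]. *)
  have eE : G1 ++ b' :: j :: e2 :: G3 ++ [:: i] = F1 ++ b :: i :: [::].
    by have := congr1 (cat^~ [:: i]) eE1; normalize.
  have [|F2 eF eG] := desc_split2 _ eE ltij; first by rewrite eE -eE0.
  exists E0, [:: b'], [:: i; b], (hop j b' G1 (e2 :: G3 ++ [:: i])), (hop i b F1 [::]),
    (slide_back [:: i; b] b').
  split=> //; [ | exact: AbsorbEnter eE0 bi _ _ _ | | ].
  + by apply: (AbsorbIn _ jb') => //; rewrite eE0 -eE.
  + apply: (opath_slide_back (U := [:: i; b])); rewrite /= andbT (distant_sym (dbb _
      bi)) andbT.
    by rewrite /distant; lia.
  rewrite eE1; rewrite eE0 -eE eG in dE0 *; rewrite eF.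
  by apply: far_square_hopr => //; have := congr1 (cat^~ [:: b]) eG; normalize.
- rewrite eE1' in eE1 eE dE dE1; subst E E1; clear dE dE1;
    case: G1 eE1 => [|f G1] [ef eE0'].
    by move: ij; rewrite ef /distant; lia.
  subst f; exists (G1 ++ [:: b']), [:: j; b'], [::], (hop j b' G1 [::]), [::], [::].
  split; try by rewrite /= eqxx.
  + exact: AbsorbEnter eE0' jb' _ _ _.
  + case: G1 eE0' => [|f G1] /=; rewrite eE0 => -[ef _];
      subst e1; exact: AbsorbExit ie _ _ _.
  rewrite eE0' in dE0 *; apply: far_square_exit => //; by_normalize.
- rewrite eE1' in eE1 eE dE dE1; subst E E1.
  have eE : F1 ++ b :: i :: e1 :: F3 = G1 ++ b' :: j :: [::] by rewrite -eE0.
  have ltji : j.+1 < i.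
    have iE : i \in (G1 ++ [:: b']) ++ [:: j].
      by rewrite -catA -eE mem_cat !inE eqxx !orbT.
    have := dE0; rewrite eE1 -[[:: b'; j]]/([:: b'] ++ [:: j]) catA => /desc_mid[/(_ i)].
    move: iE; rewrite mem_cat => /orP[-> /(_ isT) + _ | ]; first by move: ij;
        rewrite /distant; lia.
    by rewrite inE => /eqP eij; move: ij; rewrite eij distant_irr.
  have [|F2 eG eF] := desc_split2 _ eE ltji; first by rewrite -eE0.
  exists (G1 ++ [:: b']), [:: j; b'], [:: b], (hop j b' G1 [::]), (hop i b F1 (F2 ++
      [:: b'])),
    (slide b [:: j; b']).
  split=> //.
  + exact: AbsorbEnter eE1 jb' _ _ _.
  + rewrite eG -catA /=; case: F2 {eG eF} => [|f F2]; exact: AbsorbIn bi _ _ _.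
  + apply: (opath_slide (D := [:: j; b'])); rewrite /= (dbb _ bi) andbT.
    by rewrite /distant; lia.
  rewrite eG -catA /=; rewrite eE0 eF in dE0 *.
  by apply: far_square_hop => //; normalize.
rewrite eE1' in eE1; have : rcons F1 b = rcons (G1 ++ [:: b']) j by rewrite -!cats1 -catA.
by move/rcons_inj=> [_ eb]; move: ij; rewrite -eb /distant; lia.
Qed.
End Squares.

(** * Squares at adjacent edges *)

Section BraidSquares.
Variables (k : fieldType) (n : nat).
Local Notation I := 'I_n.
Local Notation eqv := (@eqv k n).
Implicit Types (x y z u v D E F G : seq I) (i j a b c e t : I) (L S C : seq (layer n)).

(** The analogue of [far_square]: after the 6-valent vertex the letters [b], [a], [b] are absorbed,
    against [a], [b], [a] without it. *)
Definition braid_square a b E0 E S1 x1 S2 x2 S3 x3 T1 y1 T2 y2 T3 H :=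
  eqv (a :: b :: a :: E0) (E ++ x3 ++ x2 ++ x1)
    (([::], KT a b, E0) :: wh [:: b; a] S1 [::] ++ wh [:: b] S2 x1 ++ wh [::] S3 (x2 ++
        x1))
    (wh [:: a; b] T1 [::] ++ wh [:: a] T2 y1 ++ wh [::] T3 (y2 ++ y1) ++ wh E H [::]).

Lemma slide_word3 (x y z : I) D :
  all (fun e => all (distant e) [:: x; y; z]) D ->
  eqv (x :: y :: z :: D) (D ++ [:: x; y; z]) (slide_word [:: x; y; z] D)
    (wh [:: x; y] (slide z D) [::] ++ wh [:: x] (slide y D) [:: z] ++
        wh [::] (slide x D) [:: y; z]).
Proof.
move=> h; have h2 : all (fun e => all (distant e) [:: y; z]) D.
  by apply: sub_all h => e /andP[].
have hx : all (distant x) D by apply: sub_all h => e /andP[/distant_sym].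
apply: eqv_trans (slide_word_cons k h) _.
apply: (eqv_ctx (u := [:: x]) (v := @nil I) (A := @nil (layer n))
  (B := wh [::] (slide x D) [:: y; z]) (slide_word_cons k h2)); [opath_auto
      | opath_auto | by_normalize | rewrite slide_word1; by_normalize].
Qed.

Lemma braid_square_far a b E0 : b = a.+1 :> nat ->
  all (distant a) E0 -> all (distant b) E0 ->
  braid_square a b E0 E0 (slide b E0) [:: b] (slide a E0) [:: a] (slide b E0) [:: b]
    (slide a E0) [:: a] (slide b E0) [:: b] (slide a E0) [:: ([::], KT a b, [::])].
Proof.
move=> eb aE bE; rewrite /braid_square /=.
have ak : kok (KT a b) by rewrite /= eb.
have dE (s : seq I) : {subset s <= [:: a; b]} -> all (fun e => all (distant e) s) E0.
  move=> sab; apply/allP => e eE; apply/allP => i /sab; rewrite !inE.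
  by case/orP=> /eqP->; apply: distant_sym; [apply: (allP aE) | apply: (allP bE)].
have aba : all (fun e => all (distant e) [:: a; b; a]) E0.
  by apply: dE => i; rewrite !inE => /or3P[] ->; rewrite ?orbT.
have bab : all (fun e => all (distant e) [:: b; a; b]) E0.
  by apply: dE => i; rewrite !inE => /or3P[] ->; rewrite ?orbT.
apply: eqv_trans (_ : eqv _ _ (wh [::] [:: ([::], KT a b, [::])] E0 ++
    slide_word [:: b; a; b] E0) _).
  close (@nil I) (@nil I) [:: (@nil I, KT a b, E0)] (@nil (layer n))
    (eqv_sym (slide_word3 bab)).
apply: eqv_trans (slide_word_nat k aba (opathk ak)) _.
close (@nil I) (@nil I) (@nil (layer n)) (wh E0 [:: (@nil I, KT a b, @nil I)] [::])
  (slide_word3 aba).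
Qed.

(** Four combinations for [b], [a], [b] survive: Far, Exit, Exit; three times Far; three times In;
    and In, Enter, Enter. The others contradict the descent of the staircases. *)
Lemma absorb_braid a b E0 E1 E2 E x1 x2 x3 S1 S2 S3 : b = a.+1 :> nat -> desc E0 ->
  absorb b E0 E1 x1 S1 -> absorb a E1 E2 x2 S2 -> absorb b E2 E x3 S3 ->
  exists E1' E2' y1 y2 y3 T1 T2 T3 H,
    [/\ absorb a E0 E1' y1 T1, absorb b E1' E2' y2 T2, absorb a E2' E y3 T3,
      opath (y3 ++ y2 ++ y1) H (x3 ++ x2 ++ x1)
    & braid_square a b E0 E S1 x1 S2 x2 S3 x3 T1 y1 T2 y2 T3 H].
Proof.
move=> eb dE0 h1 h2 h3.
have dE1 := absorb_desc h1 dE0; have dE2 := absorb_desc h2 dE1.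
have mid (F1 : seq I) c F3 : c \in F1 ++ c :: F3 by rewrite mem_cat mem_head orbT.
have aXb : distant a b = false by rewrite /distant; lia.
case: h1 => [e F eE0 be eE1 -> -> | bE0 eE1 -> -> | c e F1 F3 eE0 bc eE1 -> ->
    | c F1 eE0 bc eE1 -> ->].
(* If [b] exits first, the staircase starts with [b], also after absorbing [a]; the second [b] then
   contradicts [absorb_head]. *)
- exfalso; have ea : e = a by apply: val_inj => /=; clear -eb be || clear -eb ab'; lia.
  have nb y S F' : E2 = b :: F' -> absorb b E2 E y S -> False.
    by move=> eE2; rewrite eE2 in dE2 *; apply: absorb_head.
  case: h2 => [e' F' eE1' ae' _ _ _ | | b' e' F1 F3 _ _ eE2 _ _| b' F1 eE1' ab' eE2 _ _].
  + by move: ae'; move: eE1'; rewrite eE1 => -[<- _]; lia.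
  + by rewrite eE1 /= aXb.
  + by apply: nb h3; rewrite eE2 eE1.
  move: eE1'; rewrite eE1 eE0 ea; case: F1 eE2 => [|f F1] eE2 [ef eF].
    by apply: nb h3; rewrite eE2 ef.
  by apply: nb h3; rewrite eE2 ef.
- have nb : b \notin E0.
    by apply/negP => /(allP bE0); rewrite distant_irr.
  have nin E' (c : I) F1 F3 : E' = F1 ++ c :: b :: F3 -> b \in E'.
    by move=> ->; rewrite mem_cat !inE eqxx !orbT.
  subst E1.
  case: h2 => [e F eE0 ae eE2 -> -> | aE0 eE2 -> -> | b' e F1 F3 eE0 ab' _ _ _| b' F1
      eE0 ab' _ _ _].
  + have nb2 : b \notin E2 by rewrite eE2 inE negb_or nb andbT;
      apply/eqP => /(congr1 val) /=; lia.
    case: h3 => [e' F' eE2' be' eE -> -> | | c e' F1 F3 /nin | c F1 /nin]; last 3 first.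
    * by rewrite eE2 /= /distant; lia.
    * by rewrite (negbTE nb2).
    * by rewrite (negbTE nb2).
    (* On the other side [a] and [b] exit and the last [a] hops over them; the vertex of this hop is
       the given edge, so [H] is empty. *)
    subst E2 E; exists (a :: E0), (b :: a :: E0), [::], [::], [:: b], [::], [::],
      (hop a b [::] E0), [::]; split.
    * exact: AbsorbExit eE0 ae _ _ _.
    * exact: AbsorbExit eE2' be' _ _ _.
    * by rewrite eE0; exact: (AbsorbIn (F1 := [::])) eb _ _ _.
    * by rewrite /= eqxx.
    rewrite /braid_square.
    have [_ _ bE0'] := @desc_hop _ [::] b a E0 (absorb_desc (AbsorbExit (e := a) (F :=
        E0) erefl eb erefl erefl erefl) dE2).
    have o : opath (a :: [::] ++ b :: a :: E0) (hop a b [::] E0) ([::] ++ b :: a ::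
        E0 ++ [:: b]).
      exact: opath_hop.
    by apply: eqv_conv (eqv_refl k o) _ _ _ _; rewrite /hop /=; normalize.
  + subst E2; case: h3 => [e' F' eE0 be' _ _ _ | _ eE -> -> | c e' F1 F3 /nin
      | c F1 /nin].
    * by move: aE0; rewrite eE0 /= /distant; lia.
    * subst E; exists E0, E0, [:: a], [:: b], [:: a], (slide a E0), (slide b E0),
        (slide a E0),
        [:: ([::], KT a b, [::])]; split; try exact: AbsorbFar.
        by apply: (opathk (K := KT a b)); rewrite /= eb.
      exact: braid_square_far.
    * by rewrite (negbTE nb).
    * by rewrite (negbTE nb).
  + have eb' : b' = b by apply: val_inj => /=; clear -eb be || clear -eb ab'; lia.
    by move: (mid F1 b' (a :: e :: F3)); rewrite -eE0 eb' (negbTE nb).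
  have eb' : b' = b by apply: val_inj => /=; clear -eb be || clear -eb ab'; lia.
  by move: (mid F1 b' [:: a]); rewrite -eE0 eb' (negbTE nb).
- have ea : e = a.
    have := dE0; rewrite eE0 -[c :: _]/([:: c] ++ b :: e :: F3) catA => /desc_step be.
    by apply: val_inj => /=; clear -eb be || clear -eb ab'; lia.
  subst e E1; have dE0' : desc ((F1 ++ [:: c; b]) ++ a :: F3) by rewrite -catA -eE0.
  have dE0b : desc ((F1 ++ [:: c]) ++ b :: a :: F3) by rewrite -catA -eE0.
  have dE0c : desc (F1 ++ c :: b :: a :: F3) by rewrite -eE0.
  have [_ + bF3] := desc_hop dE0b; rewrite all_cat => /andP[aF1 _].
  have [_ bF1 /andP[_ cF3]] := desc_hop dE0c.
  case: h2 => [e F eE1 ae _ _ _ | | b' e F1' F3' eE1 ab' eE2 -> ->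
      | b' F1' eE1 ab' eE2 -> ->].
  + exfalso; have := mid F1 c (b :: a :: F3); rewrite -eE0 eE1 => /desc_head.
    by rewrite -eE1 => /(_ dE0) h; clear -h bc ae eb; lia.
  + by rewrite eE0 all_cat /= aXb !andbF.
  + have [||eF1 eF3] := @desc_uniq _ (F1 ++ [:: c; b]) a F3 (F1' ++ [:: b']) (e :: F3');
      first by [].
      by rewrite -!catA -eE0.
    subst F3 E2.
    have /rcons_inj[eF1' eb'] : rcons (F1 ++ [:: c]) b = rcons F1' b'.
      by rewrite -!cats1 -eF1 -catA.
    subst F1' b'; case: h3 => [e' F' eE' be' _ _ _ | | c' e' G1 G3 eE2 bc' eE -> ->
        | c' G1 eE2 bc' _ _ _].
    * exfalso; have := mid F1 c (b :: a :: e :: F3'); rewrite -eE0 eE' => /desc_head.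
      by rewrite -eE' => /(_ dE0) h; clear -h bc be'; lia.
    * by rewrite eE0 all_cat /= distant_irr andbF /= andbF.
    * have ec : c' = c by apply: val_inj; rewrite /= bc' bc.
      subst c'; have [||eG1 [ee eG3]] := @desc_uniq _ F1 c (b :: a :: e ::
          F3') G1 (b :: e' :: G3).
      - by [].
      - by rewrite -eE0.
      subst G1 e' G3 E.
      (* Three hops in either order: the vertex on [a], [b] in front of the staircase turns into one
         on [b], [c] behind it. *)
      exists E0, E0, [:: b], [:: c], [:: b], (hop a b (F1 ++ [:: c]) (e :: F3')),
       (hop b c F1 (a :: e :: F3')), (hop a b (F1 ++ [:: c]) (e :: F3')),
       [:: ([::], KT b c, [::])].
      have ina : absorb a E0 E0 [:: b] (hop a b (F1 ++ [:: c]) (e :: F3')).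
        by apply: AbsorbIn eb _ _ _ => //; rewrite eE0 -catA.
      split=> //; first exact: AbsorbIn eE0 bc _ _ _.
        by apply: (opathk (K := KT b c)); rewrite /= bc.
      rewrite eE0 /braid_square.
      by apply: eqv_conv (zam_full k eb bc aF1 bF1 bF3 cF3) _ _ _ _; normalize.
    have ec : c' = c by apply: val_inj; rewrite /= bc' bc.
    subst c'; have [||_ //] := @desc_uniq _ F1 c (b :: a :: e :: F3') G1 [:: b].
    - by [].
    - by rewrite -eE0.
  have [||eF1 eF3] := @desc_uniq _ (F1 ++ [:: c; b]) a F3 (F1' ++ [:: b']) [::];
      first by [].
    by rewrite -!catA -eE0.
  subst F3.
  have /rcons_inj[eF1' eb'] : rcons (F1 ++ [:: c]) b = rcons F1' b'.
      by rewrite -!cats1 -eF1 -catA.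
  subst F1' b'; rewrite -catA /= in eE2; subst E2.
  case: h3 => [e' F' eE' be' _ _ _ | | c' e' G1 G3 eE2 bc' _ _ _ | c' G1 eE2 bc' eE ->
      ->].
  + exfalso; have := mid F1 c [:: b]; rewrite eE' => /desc_head.
    by rewrite -eE' => /(_ dE2) h; clear -h bc be'; lia.
  + by rewrite all_cat /= distant_irr !andbF.
  + have ec : c' = c by apply: val_inj; rewrite /= bc' bc.
    by subst c'; have [_] := desc_uniq dE2 eE2.
  have ec : c' = c by apply: val_inj; rewrite /= bc' bc.
  subst c'; have [eG1 _] := desc_uniq dE2 eE2; subst G1 E.
  exists (F1 ++ [:: c; b]), (F1 ++ [:: c]), [:: a; b], [:: b; c], [:: a],
    (hop a b (F1 ++ [:: c]) [::]), (hop b c F1 [::]), (slide a (F1 ++ [:: c])),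
    [:: ([:: a; b], KX c a, [:: b]); ([::], KT a b, [:: c; b]);
        ([:: b; a], KT b c, [::]); ([:: b], KX a c, [:: b; c])].
  have ca : distant c a by clear -eb bc; rewrite /distant; lia.
  split.
  + by apply: (AbsorbEnter (F1 := F1 ++ [:: c]) _ eb); rewrite ?eE0 -?catA.
  + exact: AbsorbEnter bc _ _ _.
  + by apply: AbsorbFar => //; rewrite all_cat aF1 /= (distant_sym ca).
  + by rewrite /= /lsrc /ltgt /= eb bc ca (distant_sym ca) ?eqxx eb ?eqxx.
  rewrite eE0 /braid_square; apply: eqv_conv (zam_ent k eb bc aF1 bF1) _ _ _ _;
      by_normalize.
(* If [b] enters first, all remaining letters exceed [b], and the last one is [b + 1]; then [a] can
   only be Far, and the second [b] fits no case. *)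
exfalso; have gtb (e : I) : e \in F1 ++ [:: c] -> b < e.
  have dE0b : desc ((F1 ++ [:: c]) ++ [:: b]) by rewrite -catA -eE0.
  by have [h _] := desc_mid dE0b => /h.
subst E1; case: h2 => [e F eE1 ae _ _ _ | _ eE2 _ _ | b' e F1' F3' eE1 ab' _ _ _| b'
    F1' eE1 ab' _ _ _].
- by have := gtb e; rewrite eE1 mem_head => /(_ isT); lia.
- subst E2; case: h3 => [e F eE1 be _ _ _ | | c' e F1' F3' eE1 bc' _ _ _
    | c' F1' eE1 bc' _ _ _].
  + have := mid F1 c [::]; rewrite eE1 => /desc_head.
    by rewrite -eE1 => /(_ dE1); lia.
  + by rewrite all_cat /= /distant; lia.
  + by have := gtb b; rewrite eE1 mem_cat !inE eqxx !orbT ltnn => /(_ isT).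
  by have := gtb b; rewrite eE1 mem_cat !inE eqxx !orbT ltnn => /(_ isT).
- by have := gtb a; rewrite eE1 mem_cat !inE eqxx !orbT => /(_ isT); lia.
by have := gtb a; rewrite eE1 mem_cat !inE eqxx !orbT => /(_ isT); lia.
Qed.
End BraidSquares.

(** * Reduced words and wire labels *)

Section Labels.
Variable n : nat.
Local Notation I := 'I_n.
Implicit Types (x y u v E : seq I) (i j a b e t : I) (s : nat -> nat).

(* [s p] is the label of the wire in position p; [sw t s] are the labels after the
   crossing t. *)
Definition sw (t : nat) s (p : nat) : nat :=
  s (if p == t then t.+1 else if p == t.+1 then t else p).

(** Each crossing puts the larger label on the left, so no two wires cross twice. With [s] arbitrary
    this form of reducedness passes to suffixes of words. *)
Fixpoint increasing s x : bool :=
  if x is t :: y then (s t < s t.+1) && increasing (sw t s) y else true.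

Lemma eq_increasing s s' x : s =1 s' -> increasing s x = increasing s' x.
Proof.
elim: x s s' => //= t x IH s s' ss'; rewrite !ss'; congr (_ && _).
by apply: IH => p; rewrite /sw ss'.
Qed.

Lemma sw_commute i j s : distant i j -> sw i (sw j s) =1 sw j (sw i s).
Proof. by rewrite /distant /sw => ij p; congr s; do !case: ifPn; lia. Qed.

Lemma sw_braid a b s : b = a.+1 :> nat -> sw a (sw b (sw a s)) =1 sw b (sw a (sw b s)).
Proof. by rewrite /sw => -> p; congr s; do !case: ifPn; lia. Qed.

Lemma sw1 (t : nat) s : sw t s t = s t.+1.
Proof. by rewrite /sw eqxx. Qed.

Lemma swN (t p : nat) s : p != t -> p != t.+1 -> sw t s p = s p.
Proof. by rewrite /sw => /negbTE-> /negbTE->. Qed.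

(** Both sides of a move cross the same pairs of wires, in a different order. *)
Lemma increasing_edge s u K v : kok K ->
  increasing s (u ++ ksrc K ++ v) -> increasing s (u ++ ktgt K ++ v).
Proof.
move=> kK; elim: u s => [|t u IH] s /=; last by case/andP=> -> /IH.
case: K kK => [i j | a b] /= => [ij | /eqP eb].
  case/and3P=> h1 h2 h3; rewrite (eq_increasing _ (sw_commute s ij)) h3 andbT.
  have [d1 d2 d3 d4] : [/\ (i != j :> nat), (i != j.+1 :> nat), (i.+1 != j :> nat)
      & (i.+1 != j.+1 :> nat)] by move: ij; rewrite /distant; split; lia.
  by move: h2; rewrite !swN // ?h1 1?eq_sym // => ->.
case/and4P=> h1 h2 h3 h4; rewrite -(eq_increasing _ (sw_braid s eb)) h4 andbT.
have n1 : (a.+1 == a :> nat) = false by lia.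
have n2 : (a.+2 == a :> nat) = false by lia.
have n3 : (a.+2 == a.+1 :> nat) = false by lia.
have n4 : (a == a.+1 :> nat) = false by lia.
have n5 : (a == a.+2 :> nat) = false by lia.
by move: h1 h2 h3; rewrite /sw eb !(eqxx, n1, n2, n3, n4, n5) => h1 h2 h3;
    rewrite h1 h2 h3.
Qed.

Lemma increasing_opath s x L y : opath x L y -> increasing s x -> increasing s y.
Proof.
elim: L x => [|[[u K] v] L IH] x /=; first by move/eqP=> ->.
by case/and3P=> /eqP-> kK /IH h /(increasing_edge kK) /h.
Qed.

(* The wires between the two wires of the staircase come from below. *)
Definition below s E := forall e, e \in E -> s e <= s (last e E).

(** Exit and Far leave the labels on [E0] unchanged, and In permutes two of them away from the last
    letter. For Enter, [s t < s t.+1] puts the label of the entering wire below that of the lower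
    wire. *)
Lemma absorb_below t E0 E x S s : desc E0 -> absorb t E0 E x S -> s t < s t.+1 ->
  below s E -> below (sw t s) E0.
Proof.
move=> dE0 h st.
have lastE (e0 e1 : I) F : last e1 (e0 :: F) \in e0 :: F by rewrite /= mem_last.
have far (G : seq I) : (forall e, e \in G -> (e != t :> nat) && (e != t.+1 :> nat)) ->
    (forall e, e \in G -> s e <= s (last e G)) -> below (sw t s) G.
  move=> hG bG e eG; have /andP[e1 e2] := hG _ eG.
  have /andP[l1 l2] : (last e G != t :> nat) && (last e G != t.+1 :> nat).
    by apply: hG; move: eG; clear; case: G => // e0 F _; rewrite /= mem_last.
  by rewrite !swN //; apply: bG.
case: h => [e F eE0 te -> _ _ bE | tE0 -> _ _ bE | b e F1 F3 eE0 bt -> _ _ bE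
    | b F1 eE0 bt -> _ _ bE].
- apply: far => f fE; last by have := bE f; rewrite inE fE orbT eE0 => /(_ isT).
  by have := desc_head (t := e) (F := F); rewrite -eE0 => /(_ f dE0 fE); lia.
- apply: far => // f fE; have := allP tE0 f fE.
  by rewrite /distant; lia.
- have hl f : f \in E0 -> (last f E0 != t :> nat) && (last f E0 != t.+1 :> nat).
    move=> _; rewrite eE0 last_cat /=.
    have := dE0; rewrite eE0 -[b :: _]/([:: b] ++ t :: e :: F3) catA => /desc_mid[_ h].
    by have /h := lastE e e F3; rewrite /=; lia.
  move=> f fE; have /andP[l1 l2] := hl f fE; rewrite (swN _ l1 l2) /sw.
  have la g : last f E0 = last g E0 by rewrite eE0 !last_cat.
  case: eqP => [_|_].
    by rewrite -bt (la b); apply: bE; rewrite eE0 mem_cat mem_head orbT.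
  case: eqP => [_|_]; last exact: bE.
  by rewrite (la t); apply: bE; rewrite eE0 mem_cat !inE eqxx !orbT.
move=> f; rewrite eE0 last_cat /= sw1 -bt.
have bF f' : f' \in F1 ++ [:: b] -> s f' <= s b by move/bE; rewrite last_cat.
rewrite -[[:: b; t]]cat1s catA mem_cat inE => /orP[fE|/eqP->]; last by rewrite sw1 -bt.
rewrite /sw; case: eqP => [_|_]; first by rewrite -bt.
by case: eqP => [_|_]; [rewrite bt; apply: ltnW | apply: bF].
Qed.

End Labels.

(** * The exchange property and the labels of reduced words *)

Section Reduced.
Variable n : nat.
Local Notation I := 'I_n.
Implicit Types (x y u v E : seq I) (i j a b e t : I) (s : nat -> nat).

Lemma simple_reflE t (p : 'I_n.+1) :
  simple_refl t p =
    (if p == t :> nat then t.+1 else if p == t.+1 :> nat then nat_of_ord t else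
        nat_of_ord p)
  :> nat.
Proof.
have lt1 : t < n.+1 by apply: leq_trans (ltn_ord t) _.
have lt2 : t.+1 < n.+1 by rewrite ltnS.
rewrite /simple_refl permE /= -(inj_eq val_inj) -[p == _](inj_eq val_inj) /= !inordK //.
by case: ifP => _; [rewrite inordK | case: ifP => _; rewrite ?inordK].
Qed.

Lemma word_prod_rcons x t : word_prod (rcons x t) = (word_prod x * simple_refl t)%g.
Proof. by rewrite /word_prod big_rcons /=. Qed.

Lemma word_prod_cat x y : word_prod (x ++ y) = (word_prod x * word_prod y)%g.
Proof. by rewrite /word_prod big_cat. Qed.

Lemma simple_reflV t : ((simple_refl t)^-1)%g = simple_refl t.
Proof. exact: tpermV. Qed.

(** Induction on the last letter: either the transposition is conjugated through it, or it is that
    letter, which is then dropped. *)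
Lemma exchange x (p q : 'I_n.+1) :
  p < q -> ((word_prod x)^-1%g q < (word_prod x)^-1%g p) ->
  exists2 y, size y < size x & word_prod y = (word_prod x * tperm p q)%g.
Proof.
elim/last_ind: x p q => [|x t IH] p q pq.
  by rewrite /word_prod big_nil invg1 !perm1; lia.
rewrite word_prod_rcons invMg simple_reflV !permM => qp.
set p' := simple_refl t p in qp; set q' := simple_refl t q in qp.
have [ltp|leq] := ltnP p' q'.
  have [y sy ey] := IH _ _ ltp qp.
  exists (rcons y t); first by rewrite !size_rcons.
  rewrite word_prod_rcons ey -!mulgA; congr (_ * _)%g.
  have := tpermJ p' q' (simple_refl t); rewrite {3}/p' {3}/q' {3 4 5 6}/simple_refl
      !tpermK => <-.
  by rewrite conjgE !mulgA mulgV mul1g.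
(* A simple reflection reverses the order of [p < q] only when it exchanges them. *)
have [ept eqt] : p = t :> nat /\ q = t.+1 :> nat.
  by move: leq; rewrite /p' /q' !simple_reflE; do !case: ifP; lia.
exists x; first by rewrite size_rcons.
have -> : tperm p q = simple_refl t.
  by rewrite /simple_refl -eqt -ept !inord_val.
by rewrite -mulgA -{1}(simple_reflV t) mulVg mulg1.
Qed.

Fixpoint relabel s x : nat -> nat := if x is t :: y then relabel (sw t s) y else s.

Lemma relabel_rcons s x t : relabel s (rcons x t) = sw t (relabel s x).
Proof. by elim: x s => //= i x IH s; apply: IH. Qed.

Lemma relabel_word_prod x (p : 'I_n.+1) : relabel id x p = (word_prod x)^-1%g p.
Proof.
elim/last_ind: x p => [|x t IH] p; first by rewrite /word_prod big_nil invg1 perm1.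
rewrite relabel_rcons word_prod_rcons invMg simple_reflV permM -IH /sw.
by rewrite simple_reflE.
Qed.

Lemma not_increasing s x : ~~ increasing s x ->
  exists u t v, x = u ++ t :: v /\ relabel s u t.+1 <= relabel s u t.
Proof.
elim: x s => //= t x IH s; rewrite negb_and -leqNgt => /orP[h | /IH[u [t' [v [-> h]]]]].
  by exists [::], t, x.
by exists (t :: u), t', v.
Qed.

(** At a crossing [t] violating the condition, [exchange] replaces the prefix up to and including
    [t] by a shorter word, against minimality. *)
Lemma reduced_increasing w x : reduced w x -> increasing id x.
Proof.
move=> [xw minx]; apply/negPn/negP => /not_increasing[u [t [v [ex h]]]].
have lt1 : t < n.+1 by apply: leq_trans (ltn_ord t) _.
have lt2 : t.+1 < n.+1 by rewrite ltnS.
have ltpq : (inord t : 'I_n.+1) < (inord t.+1 : 'I_n.+1) by rewrite !inordK.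
have [|y sy ey] := exchange (x := u) ltpq.
  have : ((word_prod u)^-1)%g (inord t.+1) != ((word_prod u)^-1)%g (inord t).
    by rewrite (inj_eq perm_inj) -(inj_eq val_inj) /= !inordK //; lia.
  rewrite -(inj_eq val_inj) /= -!relabel_word_prod !inordK //.
  by rewrite ltn_neqAle h andbT.
have := minx (y ++ v); rewrite word_prod_cat ey -mulgA.
rewrite (_ : tperm _ _ = simple_refl t) // -xw ex word_prod_cat.
rewrite /word_prod big_cons => /(_ erefl); rewrite !size_cat /=; lia.
Qed.

End Reduced.

(** * Coherence of oriented paths *)

Section Main.
Variables (k : fieldType) (n : nat).
Local Notation I := 'I_n.
Local Notation eqv := (@eqv k n).
Implicit Types (x y z u v D E F G : seq I) (i j a b c e t : I) (L S C H : seq (layer n)).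

(** Naturality of the canonical path at the layer [l]: the path after the layer is given, the one
    before it is constructed. The two conditions exclude double crossings. *)
Definition lifts s l E y C := below s E -> increasing s (ltgt l) ->
  exists x' C' H, [/\ pull (lsrc l) E x' C', opath x' H y &
    eqv (lsrc l) (E ++ y) (l :: C) (C' ++ wh E H [::])].

Lemma absorb_singleton i j E x S : absorb i [:: j] E x S ->
  (i = j.+1 :> nat /\ [/\ E = [:: i; j], x = [::] & S = [::]]) \/
  [/\ distant i j, E = [:: j], x = [:: i] & S = slide i [:: j]].
Proof.
case=> [e F [<- _] ie -> -> -> | /= h -> -> -> | b e F1 F3 eE | b F1 eE].
- by left.
- by right; split=> //; rewrite andbT in h.
- by case: F1 eE => [|? [|? ?]].
by case: F1 eE => [|? [|? ?]].
Qed.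

Lemma lifts_X s i j v E y C : distant i j ->
  pull (j :: i :: v) E y C -> lifts s ([::], KX i j, v) E y C.
Proof.
move=> ij cC _ _; rewrite /lsrc /=; have ji := distant_sym ij.
case: cC => [[-> -> ->] | [E1 [x2 [y1 [S2 [C1 [+ h2 -> ->]]]]]]].
  (* Pulling [j]: the edge itself is the canonical path. *)
  exists (i :: v), [:: ([::], KX i j, v)], [::]; split; last by apply: eqv_refl;
      rewrite /= /lsrc /= ij !eqxx.
    right; exists [:: j], [:: i], v, (slide i [:: j]), [::]; split=> //; first by left.
    by apply: AbsorbFar; rewrite //= ij.
  by rewrite /= eqxx.
case=> [[eE1 -> ->] | [E0 [x1 [y0 [S1 [C0 [h0 h1 -> ->]]]]]]].
  (* Pulling [i]: the canonical path after the edge crosses back and cancels it. *)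
  subst E1; case: (absorb_singleton h2) => [[ej _]|[_ -> -> ->]].
    by move: ij; rewrite /distant; lia.
  exists (j :: v), [::], [::]; split; first by left.
    by rewrite /= eqxx.
  by apply: eqv_conv (eqv_wh [::] v (eqv_XX k ij)) _ _ _ _; normalize.
have dE0 := pull_desc h0.
have [E1' [y1' [y2' [T1 [T2 [H [g1 g2 hH sq]]]]]]] := absorb_swap k ij dE0 h1 h2.
have o0 := pull_opath h0.
have oS1 := absorb_opath dE0 h1; have oS2 := absorb_opath (absorb_desc h1 dE0) h2.
have oT1 := absorb_opath dE0 g1; have oT2 := absorb_opath (absorb_desc g1 dE0) g2.
exists (y2' ++ y1' ++ y0), (wh [:: i; j] C0 [::] ++ wh [:: i] T1 y0 ++
    wh [::] T2 (y1' ++ y0)),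
  (wh [::] H y0); split.
- right; exists E1', y2', (y1' ++ y0), T2, (wh [:: j] C0 [::] ++ wh [::] T1 y0).
  split=> //; last by normalize.
  by right; exists E0, y1', y0, T1, C0.
- by apply: opathw hH _ _; normalize.
rewrite /far_square in sq.
apply: eqv_trans (_ : eqv _ _ (wh [:: i; j] C0 [::] ++
  ([::], KX i j, E0 ++ y0) :: wh [:: j] S1 y0 ++ wh [::] S2 (x1 ++ y0)) _).
  normalize; close (@nil I) (@nil I) (@nil (layer n))
    (wh [:: j] S1 y0 ++ wh [::] S2 (x1 ++ y0))
    (eqv_swap k [::] (opathk (ij : kok (KX i j))) o0).
close (@nil I) y0 (wh [:: i; j] C0 [::]) (@nil (layer n)) sq.
Qed.

Lemma lifts_T s a b v E y C : b = a.+1 :> nat ->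
  pull (b :: a :: b :: v) E y C -> lifts s ([::], KT a b, v) E y C.
Proof.
move=> eb cC bE inc; rewrite /lsrc /=.
case: cC => [[-> -> ->] | [E2 [x3 [y2 [S3 [C2 [+ h3 -> ->]]]]]]].
  (* Pulling the first [b], which is the crossing of the last [a] in [a b a]: the edge is the
     canonical path. *)
  exists (a :: b :: v), [:: ([::], KT a b, v)], [::]; split.
  - right; exists [:: b; a], [:: a; b], v, (hop a b [::] [::]), [::]; split=> //.
      right; exists [:: a], [::], v, [::], [::]; split=> //; first by left.
      exact: AbsorbExit erefl eb _ _ _.
    exact: (AbsorbEnter (F1 := [::])).
  - by rewrite /= eqxx.
  by apply: eqv_refl; rewrite /= /lsrc /ltgt /= eb !eqxx.
case=> [[eE2 _ _] | [E1 [x2 [y1 [S2 [C1 [+ h2 -> ->]]]]]]].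
  subst E2; case: (absorb_singleton h3) => [[_ [eE _ _]]|[]]; last by rewrite /distant;
      lia.
  (* Pulling the middle letter: [below] gives [s b <= s a], whereas the third crossing of [b a b]
     requires [s a < s b]. *)
  exfalso; have := bE b; rewrite eE inE eqxx => /(_ isT) /= sba.
  have n1 : (a.+2 == a :> nat) = false by lia.
  have n2 : (a.+2 == a.+1 :> nat) = false by lia.
  have n3 : (a.+1 == a :> nat) = false by lia.
  have n4 : (a == a.+1 :> nat) = false by lia.
  have n5 : (a == a.+2 :> nat) = false by lia.
  move: inc; rewrite /ltgt /= => /and4P[_ _ + _].
  by rewrite eb in sba *; rewrite /sw !(eqxx, n1, n2, n3, n4, n5) ltnNge sba.
case=> [[eE1 _ _] | [E0 [x1 [y0 [S1 [C0 [h0 h1 -> ->]]]]]]].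
  (* Pulling the last [b]: the letter [a] is neither distant from [b] nor its successor, so it
     cannot be absorbed. *)
  subst E1; case: (absorb_singleton h2) => [[]|[]]; first by lia.
  by rewrite /distant; lia.
have dE0 := pull_desc h0.
have [E1' [E2' [y1' [y2' [y3' [T1 [T2 [T3 [H [g1 g2 g3 hH sq]]]]]]]]]] :=
    absorb_braid k eb dE0 h1 h2 h3.
have o0 := pull_opath h0.
have dE1 := absorb_desc h1 dE0; have dE1' := absorb_desc g1 dE0.
have oS1 := absorb_opath dE0 h1; have oS2 := absorb_opath dE1 h2.
have oS3 := absorb_opath (absorb_desc h2 dE1) h3.
have oT1 := absorb_opath dE0 g1; have oT2 := absorb_opath dE1' g2.
have oT3 := absorb_opath (absorb_desc g2 dE1') g3.
have ak : kok (KT a b) by rewrite /= eb.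
exists (y3' ++ y2' ++ y1' ++ y0), (wh [:: a; b; a] C0 [::] ++ wh [:: a; b] T1 y0 ++
  wh [:: a] T2 (y1' ++ y0) ++ wh [::] T3 (y2' ++ y1' ++ y0)), (wh [::] H y0); split.
- right; exists E2', y3', (y2' ++ y1' ++ y0), T3,
    (wh [:: b; a] C0 [::] ++ wh [:: b] T1 y0 ++ wh [::] T2 (y1' ++ y0)).
  split=> //; last by normalize.
  right; exists E1', y2', (y1' ++ y0), T2, (wh [:: a] C0 [::] ++ wh [::] T1 y0).
  split=> //; last by normalize.
  by right; exists E0, y1', y0, T1, C0.
- by apply: opathw hH _ _; normalize.
rewrite /braid_square in sq.
apply: eqv_trans (_ : eqv _ _ (wh [:: a; b; a] C0 [::] ++
  ([::], KT a b, E0 ++ y0) :: wh [:: b; a] S1 y0 ++ wh [:: b] S2 (x1 ++ y0) ++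
  wh [::] S3 (x2 ++ x1 ++ y0)) _).
  normalize; close (@nil I) (@nil I) (@nil (layer n))
    (wh [:: b; a] S1 y0 ++ wh [:: b] S2 (x1 ++ y0) ++ wh [::] S3 (x2 ++ x1 ++ y0))
    (eqv_swap k [::] (opathk ak) o0).
close (@nil I) y0 (wh [:: a; b; a] C0 [::]) (@nil (layer n)) sq.
Qed.

(** Induction on the word in front of the layer: its letters are absorbed in the same way before and
    after, and absorption commutes with [H] by interchange. *)
Lemma pull_lift s l E y C : kok l.1.2 -> pull (ltgt l) E y C -> lifts s l E y C.
Proof.
case: l => [[u K] v] /= kK; elim: u s E y C => [|t u IH] s E y C.
  case: K kK => [i j | a b] /= => [ij | /eqP eb]; [exact: lifts_X | exact: lifts_T].
rewrite /lifts /lsrc /ltgt /= => -[[-> -> ->] bE _ | [E0 [x1 [y0 [S1 [C0 [h0 h1 ->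
    ->]]]]]] bE /andP[st inc]].
  exists (u ++ ksrc K ++ v), [::], [:: (u, K, v)]; split; first by left.
    by rewrite /= kK /lsrc /ltgt /= !eqxx.
  by normalize; apply: eqv_refl; rewrite /= kK /lsrc /ltgt /= !eqxx.
have dE0 := pull_desc h0.
have [||x' [C' [H [g0 hH]]]] := IH (sw t s) E0 y0 C0 h0.
- exact: absorb_below dE0 h1 st bE.
- exact: inc.
rewrite /lsrc /= => sq.
have oS1 := absorb_opath dE0 h1; have oC' := pull_opath g0.
exists (x1 ++ x'), (wh [:: t] C' [::] ++ wh [::] S1 x'), (wh x1 H [::]); split.
- by right; exists E0, x1, x', S1, C'.
- by apply: opathw hH _ _; normalize.
normalize; apply: (eqv_step (u := [:: t]) (v := @nil I) (A := @nil (layer n)) (B :=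
    wh [::] S1 y0) sq);
  [opath_auto | opath_auto | by_normalize | normalize].
close (@nil I) (@nil I) (wh [:: t] C' [::]) (@nil (layer n))
  (eqv_sym (eqv_swap k [::] oS1 hH)).
Qed.

(** The layers are lifted one at a time, starting from the last. *)
Lemma path_lift s x L (t : I) y : opath x L (t :: y) -> increasing s x ->
  exists x' C H, [/\ pull x [:: t] x' C, opath x' H y &
    eqv x (t :: y) L (C ++ wh [:: t] H [::])].
Proof.
elim: L x => [|l L IH] x /=.
  move/eqP=> -> _; exists y, [::], [::]; split; [by left | by rewrite /= eqxx |].
  by apply: eqv_refl; rewrite /= eqxx.
case/and3P=> /eqP-> kl oL inc.
have inc' : increasing s (ltgt l).
  by case: l kl inc {oL} => [[u K] v]; apply: increasing_edge.
have [x1 [C1 [H1 [c1 o1 e1]]]] := IH _ oL inc'.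
have bt : below s [:: t] by move=> e; rewrite inE => /eqP->.
have [x0 [C0 [H0 [c0 o0 e0]]]] := pull_lift kl c1 bt inc'.
have oC0 := pull_opath c0; have oC1 := pull_opath c1.
have ol : opath (lsrc l) [:: l] (ltgt l) by rewrite /= kl !eqxx.
exists x0, C0, (H0 ++ H1); split=> //; first exact: opath_cat o0 o1.
apply: eqv_trans (eqv_cat (eqv_refl k ol) e1) _.
have oH1 := opathw (u := [:: t]) (v := [::]) o1 erefl erefl; rewrite !cats0 in oH1.
by apply: eqv_conv (eqv_cat e0 (eqv_refl k oH1)) _ _ _ _; normalize.
Qed.

Theorem opath_coherence s x L L' y : increasing s x ->
  opath x L y -> opath x L' y -> eqv x y L L'.
Proof.
elim: y s x L L' => [|t y IH] s x L L' inc oL oL'.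
  have x0 : x = [::] by apply: size0nil; rewrite (opath_size oL).
  have nil_of M : opath [::] M [::] -> M = [::] :> seq (layer n).
    by case: M => // -[[[|? ?] [? ?|? ?]] ?] M.
  by subst x; rewrite (nil_of _ oL) (nil_of _ oL'); apply: eqv_refl.
have [x1 [C1 [H1 [c1 o1 e1]]]] := path_lift oL inc.
have [x2 [C2 [H2 [c2 o2 e2]]]] := path_lift oL' inc.
(* Both factorizations begin with the same canonical path, so only [H1] and [H2] remain to be
   compared. *)
have [ex eC] := pull_inj c1 c2; subst x2 C2.
have oC := pull_opath c1.
have /= /andP[_ inc1] := increasing_opath oC inc.
have e := IH _ _ _ _ inc1 o1 o2.
apply: eqv_trans e1 _; apply: eqv_trans (eqv_sym e2).
close [:: t] (@nil I) C1 (@nil (layer n)) e.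
Qed.

End Main.

(** * Reverse oriented paths *)

Section UpsideDown.
Variables (k : fieldType) (n : nat).
Local Notation I := 'I_n.
Local Notation mor := (@mor k n).
Implicit Types (x y z u v : seq I).

Lemma upside_downK x y (f : mor x y) : upside_down (upside_down f) = f.
Proof.
elim: f => //= {x y}.
- move=> x y; case=> //= i j h; congr (Gen _ (_ _)); exact: bool_irrelevance.
- by move=> x y z g -> f ->.
- by move=> x y z t f -> g ->.
- by move=> x y f -> g ->.
by move=> x y a f ->.
Qed.

Lemma upside_down_castm x y x' y' (ex : x = x') (ey : y = y') (f : mor x y) :
  upside_down (castm ex ey f) = castm ey ex (upside_down f).
Proof. by case: _ / ex; case: _ / ey. Qed.

(** The axioms and relations are stable under this reflection; associativity of composition is read
    in the opposite direction. *)
Lemma upside_down_meq x y (f g : mor x y) : f =D g -> upside_down f =D upside_down g.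
Proof.
elim=> //= {x y f g}; intros; rewrite ?upside_down_castm; try by econstructor; eauto.
  exact/meq_rel/rel_upside_down.
exact/meq_sym/meq_compA.
Qed.

Lemma path_mor_rcons w x y z (p : expr_path w x y) (e : edge y z) (hz : reduced w z) :
  path_mor k (path_rcons p e hz) =D edge_mor k e \oD path_mor k p.
Proof.
elim: p e hz => [a ha | a b c ha e' q IH] e hz /=.
  exact: meq_trans (meq_comp1l _) (meq_sym (meq_comp1r _)).
apply: meq_trans (meq_sym (meq_compA _ _ _)).
exact: meq_comp (IH _ _) (meq_refl _).
Qed.

Lemma path_mor_rev w x y (p : expr_path w x y) :
  path_mor k (path_rev p) =D upside_down (path_mor k p).
Proof.
elim: p => [a ha | a b c ha e q IH] /=; first exact: meq_refl.
apply: meq_trans (path_mor_rcons _ _ _) _.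
apply: meq_comp IH; suff -> : edge_mor k (rev_edge e) = upside_down (edge_mor k e) by
    apply: meq_refl.
by case: e {q}.
Qed.

Lemma oriented_sem w x y (p : expr_path w x y) : oriented p ->
  exists2 L, opath x L y & sem L (path_mor k p).
Proof.
elim: p => [a ha | a b c ha e q IH] /=.
  by move=> _; exists [::]; [rewrite /= eqxx | apply: heq_refl].
case/andP=> oe /IH[L oL sL]; case: e oe q oL sL {IH} => u i j v h /= oe q oL sL.
  exists ((u, KX i j, v) :: L); first by rewrite /= h /lsrc /ltgt /= !eqxx.
  by rewrite -kmorX; exists (path_mor k q) => //; apply: heq_refl.
exists ((u, KT i j, v) :: L); first by rewrite /= oe /lsrc /ltgt /= !eqxx.
by rewrite -kmorT; exists (path_mor k q) => //; apply: heq_refl.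
Qed.

Lemma oriented_coherence w x y (f g : expr_path w x y) : reduced w x ->
  oriented f -> oriented g -> path_mor k f =D path_mor k g.
Proof.
move=> /reduced_increasing inc /oriented_sem[L oL sL] /oriented_sem[L' oL' sL'].
have [h hL hL'] := opath_coherence k inc oL oL'.
exact: meq_trans (sem_fun sL hL) (sem_fun hL' sL').
Qed.

End UpsideDown.

Theorem proposition3p10 (k : fieldType) (n : nat) (char_k : 2%N \notin [pchar k]%R)
    (w : {perm 'I_n.+1}) (x y : seq 'I_n)
    (red_x : reduced w x) (red_y : reduced w y) (f g : expr_path w x y) :
  (oriented f -> oriented g -> (path_mor k f =D path_mor k g)%D) /\
  (reverse_oriented f -> reverse_oriented g ->
     (path_mor k f =D path_mor k g)%D).
Proof.
split=> [|rf rg]; first exact: oriented_coherence.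
(* The reflected morphisms are those of the reversed paths, which are oriented. *)
rewrite -(upside_downK (path_mor k f)) -(upside_downK (path_mor k g)).
apply: upside_down_meq.
apply: meq_trans (meq_sym (path_mor_rev k f)) _; apply: meq_trans _ (path_mor_rev k g).
exact: oriented_coherence.
Qed.
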